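(* Let $F$ be a strictly balanced graph with $k$ vertices and $l\ge 1$ edges, and let $a$ be the number of automorphisms of $F$. Let $c>0$ be a constant and suppose \[ p\sim c\,N^{-k/l}\,\frac{N}{N_1}\quad (n\to\infty). \] Then the number $X_F$ of copies of $F$ in $G_p$ converges in distribution to a Poisson random variable with parameter $\lambda=c^l/a$.
   Context: Throughout, $n$ ranges over positive integers divisible by $4$ and asymptotics are as $n\to\infty$. The complete distance graph $G=G(n,n/2,n/4)=(V,E)$ has vertex set $V=\{\mathbf{x}=(x_1,\dots,x_n)\in\{0,1\}^n : x_1+\dots+x_n=n/2\}$ and edge set $E=\{\{\mathbf{x},\mathbf{y}\}: \langle \mathbf{x},\mathbf{y}\rangle=n/4\}$ (Euclidean inner product). Let $N=|V|=\binom{n}{n/2}$ and $N_1=\binom{n/2}{n/4}^2$ (the common degree in $G$). The random distance graph $G_p$ is the random spanning subgraph of $G$ in which each edge of $G$ is kept independently with probability $p=p(n)$. A graph $F$ is strictly balanced if $e(H)/v(H)<e(F)/v(F)$ for every proper nonempty subgraph $H\subset F$. *)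

(* Defs.v *)
From HB Require Import structures.
From mathcomp Require Import all_boot all_order all_algebra all_fingroup.
From mathcomp Require Import all_classical all_reals all_analysis.
Set Implicit Arguments. Unset Strict Implicit. Unset Printing Implicit Defensive.
Import Order.TTheory GRing.Theory Num.Theory.
Local Open Scope ring_scope.

Definition simple_graph (k : nat) (F : rel 'I_k) : Prop :=
  (forall i j, F i j = F j i) /\ (forall i, ~~ F i i).

Definition Fedges (k : nat) (F : rel 'I_k) : {set {set 'I_k}} :=
  [set [set i; j] | i in [set: 'I_k], j in [set j0 | F i j0]].

Definition n_aut (k : nat) (F : rel 'I_k) : nat :=
  #|[set s : {perm 'I_k} | [forall i, forall j, F (s i) (s j) == F i j]]|.

Definition strictly_balanced (R : realType) (k : nat) (F : rel 'I_k) : Prop :=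
  forall (U : {set 'I_k}) (D : {set {set 'I_k}}),
    D \subset Fedges F ->
    (forall e, e \in D -> e \subset U) ->
    U != finset.set0 ->
    (U != [set: 'I_k] \/ D != Fedges F) ->
    (#|D|%:R / #|U|%:R : R) < #|Fedges F|%:R / k%:R.

(* A 0/1 vector x in {0,1}^n is represented by its support {i | x_i = 1};
   then x_1+...+x_n = #|x| and <x,y> = #|x :&: y|. *)
Definition Vtx (n : nat) : {set {set 'I_n}} :=
  [set x : {set 'I_n} | #|x| == (n %/ 2)%N].

Definition Gedges (n : nat) : {set {set {set 'I_n}}} :=
  [set [set x; y] | x in Vtx n, y in Vtx n & #|x :&: y| == (n %/ 4)%N].

Definition NN (n : nat) : nat := 'C(n, (n %/ 2)%N).
Definition NN1 (n : nat) : nat := ('C((n %/ 2)%N, (n %/ 4)%N) ^ 2)%N.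

Definition is_copy (n k : nat) (F : rel 'I_k) (w : {set {set {set 'I_n}}})
    (WS : {set {set 'I_n}} * {set {set {set 'I_n}}}) : bool :=
  (WS.2 \subset w) &&
  [exists g : {ffun 'I_k -> {set 'I_n}},
     [&& injectiveb g, [forall i, g i \in Vtx n],
         WS.1 == g @: [set: 'I_k] &
         WS.2 == [set [set g i; g j] | i in [set: 'I_k], j in [set j0 | F i j0]]]].

Definition n_copies (n k : nat) (F : rel 'I_k) (w : {set {set {set 'I_n}}}) : nat :=
  #|[set WS | is_copy F w WS]|.

Definition Gp_weight (R : realType) (n : nat) (p : R) (w : {set {set {set 'I_n}}}) : R :=
  if w \subset Gedges n then p ^+ #|w| * (1 - p) ^+ (#|Gedges n| - #|w|) else 0.

Definition prob_XF_eq (R : realType) (n : nat) (p : R) (k : nat) (F : rel 'I_k) (j : nat) : R :=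
  \sum_(w : {set {set {set 'I_n}}} | n_copies F w == j) Gp_weight p w.

(* Main.v *)
(* Write [q j] for the probability that [X_F = j].  Conditioning on the presence of
   one copy shows that [(j + 1) * q (j + 1)] differs from [E X_F * q j] by at most a
   sum over pairs of copies sharing an edge; by strict balance this sum tends to 0, so
   [q] converges to the Poisson law as soon as [E X_F] converges to [lambda].

   This requires that the number of homomorphisms from [F] to the complete distance
   graph be asymptotic to [N^k (N1 / N)^l], which is shown by adding the vertices of [F]
   one at a time.  The number of common neighbours of vertices [x_1, ..., x_d] is [2^n]
   times the return probability of a walk with one random signed step for each of the
   [n] coordinates, the step depending only on which of the [x_j] contain the
   coordinate.  If the [2^d] cells cut out by the [x_j] all have size close to
   [n / 2^d], almost all steps form a fixed "doubled" core; positive-definiteness of the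
   law of the core then shows that the remaining steps hardly change the return
   probability, so that the number of common neighbours is almost the same for all such
   tuples.  Its average over all tuples is known exactly, by counting stars from their
   centre, and the other tuples are negligible by a Chernoff bound. *)

Require Import Defs.
From HB Require Import structures.
From mathcomp Require Import all_boot all_order all_algebra all_fingroup.
From mathcomp Require Import all_classical all_reals all_analysis.
From mathcomp Require Import ring lra zify fintype finset.
Import Order.TTheory GRing.Theory Num.Theory numFieldNormedType.Exports.
Set Implicit Arguments. Unset Strict Implicit. Unset Printing Implicit Defensive.
Local Open Scope ring_scope.

(** The scales are uneven: [N] is exponential in [n], while the density [N1 / N] is only
    polynomially small. Strict balance gains a factor [N^(-1/l)], so any fixed power of [N / N1]
    lost in the pair sums is harmless. The homomorphism count, however, must be right up to a factor
    [1 + o(1)]. No local limit theorem is proved for this: the return probability of the core is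
    never evaluated, only compared with the law of the same core at nearby points, and the exact
    average then supplies its value.

    The walk is run modulo an integer exceeding all its displacements, in a group of order
    polynomial in [n]; squared norms bounded below by the inverse order can decay only slowly, and
    this is what makes the law of the core flat. Flatness is obtained along doubled vectors only, so
    the total displacement of the remaining steps has to be even, which the divisibility of [n] by 4
    ensures. Allowing deviations of order [n^(3/4)] in the cell sizes gives a relative loss of order
    [n^(-1/4) ln n], while the proportion of other tuples is at most [exp(- n^(1/2) / 4)] up to
    powers of [n]. *)

(** * Poisson approximation *)

Section RandomSubset.
Variables (R : realFieldType) (T : finType) (Gs : {set T}) (p : R).
Hypothesis p01 : 0 <= p <= 1.

Definition wt (w : {set T}) : R :=
  if w \subset Gs then p ^+ #|w| * (1 - p) ^+ (#|Gs| - #|w|) else 0.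

Lemma wt_ge0 w : 0 <= wt w.
Proof.
rewrite /wt; case: ifP => // _; case/andP: p01 => p0 p1.
by rewrite mulr_ge0 // exprn_ge0 // subr_ge0.
Qed.

(** The odds of one edge, cross-multiplied so as to hold at [p = 1] too. *)
Lemma wt_setU1 e (w : {set T}) : e \in Gs -> e \notin w -> (1 - p) * wt (e |: w) = p * wt w.
Proof.
move=> eG ew; rewrite /wt subUset sub1set eG /=; case: ifP => wG; last by rewrite !mulr0.
rewrite cardsU1 ew /=.
have lt : (#|w| < #|Gs|)%N.
  by apply: proper_card; apply/properP; split=> //; exists e.
rewrite -[(#|Gs| - #|w|)%N]prednK ?subn_gt0 // -subnS !exprS; ring.
Qed.

Lemma sum_wt_mem e (g : {set T} -> R) : e \in Gs ->
  (forall w, g w = g (w :\ e)) ->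
  \sum_(w : {set T}) wt w * (e \in w)%:R * g w = p * \sum_(w : {set T}) wt w * g w.
Proof.
move=> eG ge.
rewrite (bigID (fun w : {set T} => e \in w)) /=.
rewrite [X in _ + X]big1 ?addr0; last by move=> w /negbTE ->; rewrite mulr0 mul0r.
rewrite (eq_bigr (fun w => wt w * g w)); last by move=> w ->; rewrite mulr1.
rewrite [X in _ = p * X](bigID (fun w : {set T} => e \in w)) /=.
set a := \sum_(w : {set T} | e \in w) _; set b := \sum_(w : {set T} | e \notin w) _.
suff : (1 - p) * a = p * b by move=> h; rewrite mulrDr -h; ring.
rewrite /a /b (reindex_onto (fun w : {set T} => e |: w) (fun w => w :\ e)) /=; last first.
  by move=> w ew; rewrite setD1K.
rewrite (eq_bigl (fun w : {set T} => e \notin w)); last first.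
  move=> w; rewrite setU11 /=; apply/eqP/idP => [<-|ew]; first by rewrite !inE eqxx.
  by rewrite setU1K.
rewrite !mulr_sumr; apply: eq_bigr => w ew.
rewrite [LHS]mulrA [RHS]mulrA wt_setU1 //; congr (_ * _); by rewrite ge setU1K.
Qed.

(** Independence of the presence of [S] and of anything that ignores [S], by removing one element of
    [S] at a time. *)
Lemma sum_wt_sub (S : {set T}) (g : {set T} -> R) : S \subset Gs ->
  (forall w, g w = g (w :\: S)) ->
  \sum_(w : {set T}) wt w * (S \subset w)%:R * g w =
  p ^+ #|S| * \sum_(w : {set T}) wt w * g w.
Proof.
move: {2}#|S| (leqnn #|S|) => n; elim: n S g => [|n IH] S g.
  rewrite leqn0 cards_eq0 => /eqP -> _ _; rewrite cards0 expr0 mul1r.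
  by apply: eq_bigr => w _; rewrite sub0set mulr1.
move=> Sn SG gS; have [S0|[e eS]] := set_0Vmem S.
  rewrite S0 cards0 expr0 mul1r.
  by apply: eq_bigr => w _; rewrite sub0set mulr1.
have cS : #|S| = (#|S :\ e|).+1 by rewrite (cardsD1 e S) eS.
have gS' w (A : {set T}) : A \subset S -> g w = g (w :\: A).
  move=> AS; rewrite gS [in RHS]gS; congr g; apply/setP => x; rewrite !inE.
  by case: (boolP (x \in S)) => //= xS; case: (boolP (x \in A)) => // /(subsetP AS); rewrite (negbTE xS).
transitivity (\sum_(w : {set T}) wt w * (e \in w)%:R * ((S :\ e \subset w)%:R * g w)).
  apply: eq_bigr => w _; rewrite -{1}(setD1K eS) subUset sub1set -mulnb natrM; ring.
rewrite sum_wt_mem; last first.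
- move=> w; rewrite -(gS' w [set e]) ?sub1set //; congr (_%:R * _).
  congr nat_of_bool; apply/idP/idP => /subsetP h; apply/subsetP => x xS.
    by rewrite !inE h // andbT; move: xS; rewrite !inE => /andP[].
  by have := h x xS; rewrite !inE => /andP[].
- exact: (subsetP SG).
rewrite (eq_bigr (fun w => wt w * (S :\ e \subset w)%:R * g w)); last by move=> *; rewrite mulrA.
rewrite IH ?cS ?exprS ?mulrA //; last by move=> w; exact/gS'/subD1set.
- by rewrite -ltnS -cS.
- by apply: subset_trans SG; apply: subD1set.
Qed.

(** Independence with [S = Gs]: only [w = Gs] both has weight and contains [Gs], so [p ^+ #|Gs|]
    equals itself times the total mass. Cancelling requires [p != 0], hence the separate case. *)
Lemma sum_wt : \sum_(w : {set T}) wt w = 1.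
Proof.
have [p0|p0] := eqVneq p 0.
  rewrite (bigD1 set0) //= big1 ?addr0.
    by rewrite /wt sub0set cards0 p0 subr0 expr1n expr0 mulr1.
  by move=> w w0; rewrite /wt p0 expr0n cards_eq0 (negbTE w0) mul0r if_same.
have := @sum_wt_sub Gs (fun _ => 1) (subxx _) (fun _ => erefl _).
rewrite [LHS](eq_bigr (fun w => if w == Gs then p ^+ #|Gs| else 0)); last first.
  move=> w _; rewrite mulr1; have [->|wG] := eqVneq w Gs.
    by rewrite /wt subxx subnn expr0 !mulr1.
  rewrite /wt; case: ifP => wsG; last by rewrite mul0r.
  case: (boolP (Gs \subset w)) => h; last by rewrite mulr0.
  by case/eqP: wG; apply/eqP; rewrite eqEsubset wsG h.
rewrite -big_mkcond big_pred1_eq (eq_bigr wt) => [/esym|w _]; last by rewrite mulr1.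
have pn0 : p ^+ #|Gs| != 0 by apply: expf_neq0.
by move=> h; apply: (mulfI pn0); rewrite mulr1 h.
Qed.

Lemma sum_wt_subset (S : {set T}) : S \subset Gs ->
  \sum_(w : {set T}) wt w * (S \subset w)%:R = p ^+ #|S|.
Proof.
move=> SG; rewrite -[RHS]mulr1 -[X in _ = _ * X]sum_wt.
have := @sum_wt_sub S (fun _ => 1) SG (fun _ => erefl _).
rewrite (eq_bigr (fun w : {set T} => wt w * (S \subset w)%:R)) => [->|w _]; last by rewrite mulr1.
by congr (_ * _); apply: eq_bigr => w _; rewrite mulr1.
Qed.

Section Count.
Variables (I : finType) (C : {set I}) (E : I -> {set T}).
Hypothesis EG : forall a, a \in C -> E a \subset Gs.
Hypothesis E0 : forall a, a \in C -> E a != set0.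

Definition cnt (w : {set T}) := #|[set a in C | E a \subset w]|.
Definition mean := \sum_(a in C) p ^+ #|E a|.
Definition pr j := \sum_(w : {set T}) wt w * (cnt w == j)%:R.

Lemma cntE w : (cnt w)%:R = \sum_(a in C) (E a \subset w)%:R :> R.
Proof.
rewrite /cnt -sum1_card natr_sum (eq_bigl (fun a => (a \in C) && (E a \subset w))); last first.
  by move=> a; rewrite inE.
by rewrite big_mkcondr /=; apply: eq_bigr => a _; case: ifP.
Qed.

Lemma mean_cnt : \sum_(w : {set T}) wt w * (cnt w)%:R = mean.
Proof.
under eq_bigr do rewrite cntE mulr_sumr.
by rewrite exchange_big /=; apply: eq_bigr => a aC; rewrite sum_wt_subset // EG.
Qed.

Definition meets a b := ~~ [disjoint E a & E b].

(** The error terms of the Chen-Stein method with [meets] as dependency relation: joint presence of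
    two distinct meeting copies, and products of probabilities, diagonal included. *)
Definition pairs_err :=
  \sum_(a in C) \sum_(b in C | (b != a) && meets a b)
     (p ^+ #|E a :|: E b| + p ^+ (#|E a| + #|E b|)) + \sum_(a in C) p ^+ (#|E a| + #|E a|).

(* Given that copy [a] is present, the count is one plus the number [Wa] of present
   copies sharing no edge with [a], unless another copy meeting [a] is present;
   and [Wa] is independent of [a] and differs from the count only if some
   copy meeting [a] is present. *)
Lemma pr_recursion j : `|j.+1%:R * pr j.+1 - mean * pr j| <= pairs_err.
Proof.
have -> : j.+1%:R * pr j.+1 =
    \sum_(a in C) \sum_(w : {set T}) wt w * (E a \subset w)%:R * (cnt w == j.+1)%:R.
  rewrite /pr mulr_sumr exchange_big /=; apply: eq_bigr => w _.
  have [h|h] := eqVneq (cnt w) j.+1; last by rewrite !mulr0 big1 // => a _; rewrite mulr0.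
  by under eq_bigr do rewrite mulr1; rewrite -mulr_sumr -cntE h mulr1 mulrC.
rewrite /mean mulr_suml -sumrB; apply: le_trans (ler_norm_sum _ _ _) _.
rewrite /pairs_err -big_split /=; apply: ler_sum => a aC.
set Wa := fun w : {set T} => #|[set b in C | ~~ meets a b && (E b \subset w)]|.
have WaD w : Wa w = Wa (w :\: E a).
  apply: eq_card => b; rewrite !inE; case: (b \in C) => //=; rewrite negbK.
  case: (boolP [disjoint _ & _]) => //= dab.
  by rewrite subsetD (disjoint_sym (mem (E b))) dab andbT.
have := @sum_wt_sub (E a) (fun w => (Wa w == j)%:R) (EG aC) _.
move=> /(_ (fun w => congr1 (fun x => (x == j)%:R) (WaD w))) indep.
set err1 := \sum_(b in C | (b != a) && meets a b) p ^+ #|E a :|: E b|.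
set err2 := \sum_(b in C | (b != a) && meets a b) p ^+ (#|E a| + #|E b|) + p ^+ (#|E a| + #|E a|).
have -> : \sum_(b in C | (b != a) && meets a b)
     (p ^+ #|E a :|: E b| + p ^+ (#|E a| + #|E b|)) + p ^+ (#|E a| + #|E a|) = err1 + err2.
  by rewrite /err1 /err2 addrA -big_split.
have maa : meets a a by rewrite /meets -setI_eq0 setIid E0.
have cntW w : cnt w = (Wa w + #|[set b in C | meets a b && (E b \subset w)]|)%N.
  rewrite /cnt -(cardsID [set b | ~~ meets a b]); congr (_ + _)%N; apply: eq_card => b;
  rewrite !inE ?negbK; case: (b \in C); case: (meets a b); case: (E b \subset w); rewrite ?andbF ?andbT //=.
have WS (w : {set T}) : (#|[set b in C | meets a b && (E b \subset w)]| =
   #|[set b in C | (b != a) && meets a b && (E b \subset w)]| + (E a \subset w))%N.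
  rewrite (cardsD1 a) inE aC maa /= addnC; congr (_ + _)%N; apply: eq_card => b.
  by rewrite !inE; case: (b == a); rewrite ?andbF //=; case: (b \in C).
have sumW (w : {set T}) (Q : pred I) : (#|[set b in C | Q b && (E b \subset w)]|%:R : R) =
    \sum_(b in C | Q b) (E b \subset w)%:R.
  rewrite -sum1_card natr_sum (eq_bigl (fun b => ((b \in C) && Q b) && (E b \subset w))).
    by rewrite big_mkcondr /=; apply: eq_bigr => b _; case: ifP.
  by move=> b; rewrite inE andbA.
(* Two indicators that agree when [z = 0] differ by at most [z]: taking expectations then gives a
   Markov bound directly. *)
have bool_diff (x y : nat) (b : bool) (z : nat) : (z = 0%N -> b = (x == y)) ->
    `|b%:R - (x == y)%:R| <= z%:R :> R.
  case: z => [->//|z _]; first by rewrite subrr normr0.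
  apply: le_trans (_ : 1 <= _); last by rewrite ler1n.
  by case: b; case: (x == y); rewrite ?subrr ?normr0 ?subr0 ?sub0r ?normrN ?normr1.
set A1 := \sum_(w : {set T}) wt w * (E a \subset w)%:R * (Wa w == j)%:R in indep.
(* The count [j + 1] is first replaced by [Wa = j] on the event that [a] is present, at cost [err1];
   by independence that event factors out, and [Wa] is turned back into the full count at cost
   [err2]. *)
rewrite (_ : _ - _ = (\sum_(w : {set T}) wt w * (E a \subset w)%:R * (cnt w == j.+1)%:R - A1) +
   p ^+ #|E a| * (\sum_(w : {set T}) wt w * (Wa w == j)%:R - pr j)); last by rewrite indep; ring.
apply: le_trans (ler_normD _ _) _; apply: lerD.
- rewrite /A1 -sumrB; apply: le_trans (ler_norm_sum _ _ _) _.
  have -> : err1 = \sum_(w : {set T}) wt w * (E a \subset w)%:R *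
      #|[set b in C | (b != a) && meets a b && (E b \subset w)]|%:R.
    under eq_bigr do rewrite sumW mulr_sumr.
    rewrite exchange_big /=; apply: eq_bigr => b /andP[bC _].
    rewrite -sum_wt_subset ?subUset ?EG //; apply: eq_bigr => w _.
    by rewrite subUset -mulrA -natrM mulnb.
  apply: ler_sum => w _; rewrite -mulrBr normrM ger0_norm ?mulr_ge0 ?wt_ge0 //.
  case: (boolP (E a \subset w)) => Eaw; last by rewrite mulr0 !mul0r.
  apply: ler_wpM2l; first by rewrite mulr_ge0 ?wt_ge0.
  by apply: bool_diff => z0; rewrite cntW WS z0 Eaw add0n addn1 eqSS.
- rewrite normrM ger0_norm ?exprn_ge0 //; last by case/andP: p01.
  have -> : err2 = p ^+ #|E a| * \sum_(b in C | meets a b) p ^+ #|E b|.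
    rewrite (bigD1 a) /=; last by rewrite aC.
    rewrite /err2 addrC mulrDr -exprD; congr (_ + _); rewrite mulr_sumr.
    apply: eq_big => b; first by rewrite -andbA [meets a b && _]andbC.
    by rewrite exprD.
  apply: ler_wpM2l; first by rewrite exprn_ge0 //; case/andP: p01.
  rewrite /pr -sumrB; apply: le_trans (ler_norm_sum _ _ _) _.
  have -> : \sum_(b in C | meets a b) p ^+ #|E b| =
     \sum_(w : {set T}) wt w * #|[set b in C | meets a b && (E b \subset w)]|%:R.
    under [in RHS]eq_bigr do rewrite sumW mulr_sumr.
    rewrite exchange_big /=; apply: eq_bigr => b /andP[bC _].
    by rewrite sum_wt_subset ?EG.
  apply: ler_sum => w _; rewrite -mulrBr normrM ger0_norm ?wt_ge0 //.
  apply: ler_wpM2l; first by rewrite wt_ge0.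
  by rewrite distrC; apply: bool_diff; rewrite cntW => ->; rewrite addn0.
Qed.

Lemma pr_ge0 j : 0 <= pr j.
Proof. by apply: sumr_ge0 => w _; rewrite mulr_ge0 ?wt_ge0. Qed.

Lemma sum_pr K : \sum_(j < K) pr j = \sum_(w : {set T}) wt w * (cnt w < K)%:R.
Proof.
rewrite /pr exchange_big /=; apply: eq_bigr => w _; rewrite -mulr_sumr; congr (_ * _).
case: (ltnP (cnt w) K) => h.
  rewrite (bigD1 (Ordinal h)) //= eqxx big1 ?addr0 // => i ih.
  by apply/eqP; rewrite pnatr_eq0 eqb0; apply: contra ih => /eqP e; apply/eqP/val_inj.
rewrite big1 // => i _; apply/eqP; rewrite pnatr_eq0 eqb0; apply/eqP => e.
by have := ltn_ord i; rewrite -e ltnNge h.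
Qed.

Lemma sum_pr_le1 K : \sum_(j < K) pr j <= 1.
Proof.
rewrite sum_pr -[leRHS]sum_wt; apply: ler_sum => w _.
by rewrite -[leRHS]mulr1 ler_wpM2l ?wt_ge0 // lern1 leq_b1.
Qed.

(** Markov's inequality; it keeps mass from escaping to infinity in the limit. *)
Lemma sum_pr_ge K : 1 - mean / K.+1%:R <= \sum_(j < K.+1) pr j.
Proof.
rewrite sum_pr -[X in X - _]sum_wt -mean_cnt mulr_suml -sumrB; apply: ler_sum => w _.
rewrite -mulrA -[X in X - _]mulr1 -mulrBr ler_wpM2l ?wt_ge0 //.
case: ltnP => h; first by rewrite gerBl divr_ge0.
by rewrite subr_le0 ler_pdivlMr ?ltr0n // mul1r ler_nat.
Qed.

End Count.
End RandomSubset.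

(** * From the approximate recursion to the Poisson law *)

Section PoissonLimit.
Local Open Scope classical_set_scope.

Lemma cvgr0_bounded_mul (R : realType) (u v : nat -> R) (M : R) :
  (forall n, `|v n| <= M) -> u @ \oo --> (0 : R) -> (fun n => u n * v n) @ \oo --> (0 : R).
Proof.
move=> vM u0; apply/norm_cvg0P.
apply: (@squeeze_cvgr _ _ _ _ (fun=> 0) (fun n => `|u n| * M)).
- near=> n; rewrite /= normr_ge0 /= normrM ler_wpM2l //.
- exact: cvg_cst.
- by rewrite -(mul0r M); apply: cvgMl; rewrite -(normr0 R); apply: cvg_norm.
Unshelve. all: by end_near. Qed.

Lemma cvgr_sum (R : realType) (I : Type) (s : seq I) (P : pred I) (f : I -> nat -> R) (l : I -> R) :
  (forall i, P i -> f i @ \oo --> l i) ->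
  (fun n => \sum_(i <- s | P i) f i n) @ \oo --> \sum_(i <- s | P i) l i.
Proof.
move=> fl; elim: s => [|i s IH].
  by rewrite big_nil; under eq_fun do rewrite big_nil; apply: cvg_cst.
rewrite big_cons; under eq_fun do rewrite big_cons.
by case: (boolP (P i)) => // Pi; apply: cvgD => //; apply: fl.
Qed.

Lemma cvgr_expn (R : realType) (u : nat -> R) (l : R) k :
  u @ \oo --> l -> (fun n => u n ^+ k) @ \oo --> l ^+ k.
Proof.
move=> ul; elim: k => [|k IH].
  by under eq_fun do rewrite expr0; rewrite expr0; apply: cvg_cst.
by under eq_fun do rewrite exprS; rewrite exprS; apply: cvgM.
Qed.

(** The recursion forces [q n i] to be close to [lam ^+ i / i!] times [q n 0]. The bounds on partial
    sums then act as normalisation and force [q n 0] to tend to the inverse of the exponential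
    series. *)
Lemma poisson_limit (R : realType) (q : nat -> nat -> R) (mu : nat -> R) (lam : R) :
  0 < lam -> (forall n j, 0 <= q n j) ->
  (forall j, (fun n => j.+1%:R * q n j.+1 - mu n * q n j) @ \oo --> (0 : R)) ->
  mu @ \oo --> lam ->
  (forall n K, \sum_(j < K) q n j <= 1) ->
  (forall n K, 1 - mu n / K.+1%:R <= \sum_(j < K.+1) q n j) ->
  forall j, (fun n => q n j) @ \oo --> poisson_pmf lam j.
Proof.
move=> lam0 q0 rec mulam le1 ge1 j.
have q1 n i : `|q n i| <= 1.
  rewrite ger0_norm //; apply: le_trans (le1 n i.+1).
  by rewrite big_ord_recr /= lerDr sumr_ge0.
pose r i : R := lam ^+ i / i`!%:R.
have step i : (fun n => q n i - r i * q n 0%N) @ \oo --> (0 : R).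
  elim: i => [|i IH].
    by under eq_fun do rewrite /r expr0 fact0 divr1 mul1r subrr; apply: cvg_cst.
  have -> : (fun n => q n i.+1 - r i.+1 * q n 0%N) =
    (fun n => i.+1%:R^-1 * ((i.+1%:R * q n i.+1 - mu n * q n i) +
      ((mu n - lam) * q n i + lam * (q n i - r i * q n 0%N)))).
    apply/funext => n; rewrite /r exprS factS natrM.
    have f0 : (i`!%:R : R) != 0 by rewrite pnatr_eq0 -lt0n fact_gt0.
    have s0 : (i.+1%:R : R) != 0 by rewrite pnatr_eq0.
    by field; rewrite f0 addrC natr1 s0.
  rewrite -(mulr0 i.+1%:R^-1); apply: cvgMr; rewrite -[X in _ --> X]addr0.
  apply: cvgD => //; rewrite -[X in _ --> X]addr0; apply: cvgD.
    apply: (@cvgr0_bounded_mul _ _ _ 1) => //.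
    by rewrite -(subrr lam); apply: cvgB => //; apply: cvg_cst.
  by rewrite -[X in _ --> X](mulr0 lam); apply: cvgMr.
have q0lim : (fun n => q n 0%N) @ \oo --> expR (- lam).
  apply/cvgrPdist_le => e e0.
  pose S K := \sum_(i < K) r i.
  have S1 K : 1 <= S K.+1.
    rewrite /S big_ord_recl /r expr0 fact0 divr1 lerDl sumr_ge0 // => i _.
    by rewrite divr_ge0 ?exprn_ge0 // ltW.
  have Slim : (fun K => (S K.+1)^-1) @ \oo --> expR (- lam).
    rewrite expRN; apply: cvgV; first by rewrite gt_eqF ?expR_gt0.
    rewrite -[X in X @ _]/(fun K => S K.+1).
    have := is_cvg_series_exp_coeff lam; rewrite /expR => h.
    rewrite (_ : S = series (exp_coeff lam)).
      by rewrite (cvg_shiftS (series (exp_coeff lam))).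
    by apply/funext => K; rewrite /S /series /= big_mkord.
  have e30 : 0 < e / 3 by lra.
  (* Three errors of [e / 3]: truncating the exponential series, the mass beyond [K], and the
     recursion up to [K]. Here [lam + 1] bounds [mu n] for large [n]. *)
  have [K [SK lamK]] : exists K, `|expR (- lam) - (S K.+1)^-1| <= e / 3 /\
      (lam + 1) / K.+1%:R <= e / 3.
    have h1 : \forall K \near \oo, `|expR (- lam) - (S K.+1)^-1| <= e / 3.
      by move/cvgrPdist_le : Slim; apply.
    have h2 : \forall K \near \oo, (lam + 1) / K.+1%:R <= e / 3.
      near=> K; rewrite ler_pdivrMr // mulrC -ler_pdivrMr //.
      apply: le_trans (_ : K%:R <= _); last by rewrite ler_nat.
      by near: K; exact: nbhs_infty_ger.
    have [K _ /(_ K (leqnn K)) [? ?]] : \forall K \near \oo,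
      `|expR (- lam) - (S K.+1)^-1| <= e / 3 /\ (lam + 1) / K.+1%:R <= e / 3.
      by apply: filterS2 h1 h2.
    by exists K.
  have dlim : (fun n => \sum_(i < K.+1) (q n i - r i * q n 0%N)) @ \oo --> (0 : R).
    rewrite (_ : nbhs (0 : R) = nbhs (\sum_(i < K.+1) (0 : R))); last by rewrite big1.
    by apply: (@cvgr_sum _ _ _ _ (fun (i : 'I_K.+1) n => q n i - r i * q n 0%N) (fun=> 0)) => i _; apply: step.
  near=> n.
  have mun : mu n <= lam + 1.
    rewrite addrC -lerBlDr; apply: le_trans (ler_norm _) _; rewrite distrC.
    by near: n; move/cvgrPdist_le : mulam; apply.
  have dn : `|\sum_(i < K.+1) (q n i - r i * q n 0%N)| <= e / 3.
    by near: n; move/cvgr0Pnorm_le : dlim; apply.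
  rewrite (_ : \sum_(i < K.+1) (q n i - r i * q n 0%N) =
     (\sum_(i < K.+1) q n i) - S K.+1 * q n 0%N) in dn; last first.
    by rewrite sumrB -mulr_suml.
  have := le1 n K.+1; have := ge1 n K.
  have muK : mu n / K.+1%:R <= e / 3.
    by apply: le_trans lamK; rewrite ler_wpM2r.
  move: dn muK; set Q := \sum_(i < K.+1) _; set s := S K.+1 in SK *.
  set x := q n 0%N; set m := mu n / _ => dn muK h1 h2.
  have s1 : 1 <= s := S1 K.
  have : `|s^-1 - x| <= e / 3 + e / 3.
    rewrite (_ : s^-1 - x = s^-1 * (1 - s * x)); last by rewrite mulrBr mulr1 mulrA mulVf ?mul1r //; lra.
    rewrite normrM; apply: le_trans (_ : 1 * `|1 - s * x| <= _).
      by rewrite ler_wpM2r // ger0_norm ?invf_le1 ?invr_ge0; lra.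
    move: dn; rewrite mul1r !ler_norml => /andP[? ?]; apply/andP; split; lra.
  move: SK; rewrite !ler_norml => /andP[? ?] /andP[? ?]; apply/andP; split; lra.
rewrite (_ : (fun n => q n j) = (fun n => (q n j - r j * q n 0%N) + r j * q n 0%N)); last first.
  by apply/funext => n; rewrite subrK.
rewrite /poisson_pmf lam0 -[X in _ --> X]add0r; apply: cvgD => //.
exact: cvgMr.
Unshelve. all: by end_near. Qed.

End PoissonLimit.

(** * Return probabilities of random walks on finite abelian groups *)

Section Walk.
Variables (R : realType) (V : finZmodType).
Implicit Types (f h : V -> R) (s : seq V) (g u v : V).

Definition avg_step g f v : R := (f (v - g) + f (v + g)) / 2.

Fixpoint walk s : V -> R :=
  if s is g :: s' then avg_step g (walk s') else fun v => (v == 0)%:R.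

Lemma walk_ge0 s v : 0 <= walk s v.
Proof. by elim: s v => [|g s IH] v //=; rewrite divr_ge0 ?addr_ge0. Qed.

Lemma sum_shift f u : \sum_v f (v + u) = \sum_v f v.
Proof. by rewrite [RHS](reindex_inj (addIr u)). Qed.

Lemma sum_avg_step g f : \sum_v avg_step g f v = \sum_v f v.
Proof. by rewrite -mulr_suml big_split /= !sum_shift; lra. Qed.

Lemma sum_walk s : \sum_v walk s v = 1.
Proof.
elim: s => [|g s IH] /=; last by rewrite sum_avg_step.
by rewrite (bigD1 0) //= eqxx big1 ?addr0 // => v /negbTE ->.
Qed.

Lemma walk_le1 s v : walk s v <= 1.
Proof.
rewrite -(sum_walk s) (bigD1 v) //= lerDl.
by apply: sumr_ge0 => u _; apply: walk_ge0.
Qed.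

Lemma eq_avg_step g f h : f =1 h -> avg_step g f =1 avg_step g h.
Proof. by move=> fh v; rewrite /avg_step !fh. Qed.

Lemma avg_stepC g g' f : avg_step g (avg_step g' f) =1 avg_step g' (avg_step g f).
Proof.
move=> v; rewrite /avg_step (addrAC v (- g) (- g')) (addrAC v (- g) g').
by rewrite (addrAC v g (- g')) (addrAC v g g'); lra.
Qed.

Lemma walk_catC g s t : walk (s ++ g :: t) =1 walk (g :: s ++ t).
Proof.
elim: s => [//|g' s IH] v /=.
by rewrite (eq_avg_step _ IH) /= avg_stepC.
Qed.

Lemma walk_perm s t : perm_eq s t -> walk s =1 walk t.
Proof.
elim: s t => [|g s IH] t.
  by move=> /perm_size/esym/size0nil ->.
move=> pst; have gt : g \in t by rewrite -(perm_mem pst) mem_head.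
have [t1 [t2 et]] : exists t1 t2, t = t1 ++ g :: t2.
  by case/splitPr: gt => t1 t2; exists t1, t2.
move: pst; rewrite et => pst v; rewrite walk_catC /=; apply: eq_avg_step; apply: IH.
rewrite -(perm_cons g); apply: (perm_trans pst); exact: permEl (perm_catCA t1 [:: g] t2).
Qed.

Lemma walkN s v : walk s (- v) = walk s v.
Proof.
elim: s v => [|g s IH] v /=; first by rewrite oppr_eq0.
have e1 : - v - g = - (v + g) by rewrite opprD.
have e2 : - v + g = - (v - g) by rewrite opprB addrC.
by rewrite /avg_step e1 e2 !IH addrC.
Qed.

(** Autocorrelation of [f], and squared L2 distance from [f] to its translate. For [f = walk s] the
    former is the law of the doubled walk [s ++ s], and half the latter is its drop from the value
    at 0. *)
Definition corr f v : R := \sum_a f a * f (a - v).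
Definition incr2 f v : R := \sum_a (f a - f (a - v)) ^+ 2.

Lemma walk_cat s t v : walk (s ++ t) v = \sum_a walk t a * walk s (v - a).
Proof.
elim: s v => [|g s IH] v /=.
  rewrite (bigD1 v) //= subrr eqxx mulr1 big1 ?addr0 // => a av.
  by rewrite subr_eq0 eq_sym (negbTE av) mulr0.
rewrite /avg_step !IH -big_split /= mulr_suml; apply: eq_bigr => a _.
by rewrite -mulrDr -mulrA (addrAC v (- a)) (addrAC v (- a)).
Qed.

Lemma walk_corr s v : walk (s ++ s) v = corr (walk s) v.
Proof. by rewrite walk_cat; apply: eq_bigr => a _; rewrite -(walkN s (a - v)) opprB. Qed.

Lemma corr0 f : corr f 0 = \sum_a f a ^+ 2.
Proof. by apply: eq_bigr => a _; rewrite subr0. Qed.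

Lemma corr_incr2 f v : corr f 0 - corr f v = incr2 f v / 2.
Proof.
have h : incr2 f v = corr f 0 + corr f 0 - 2 * corr f v.
  rewrite {2}corr0 -(sum_shift (fun a => f a ^+ 2) (- v)) corr0 /corr mulr_sumr.
  by rewrite -big_split -sumrB /=; apply: eq_bigr => a _; ring.
by rewrite h; lra.
Qed.

Lemma incr2_ge0 f v : 0 <= incr2 f v.
Proof. by apply: sumr_ge0 => a _; apply: sqr_ge0. Qed.

Lemma corr_le f v : corr f v <= corr f 0.
Proof. by rewrite -subr_ge0 corr_incr2 divr_ge0 ?incr2_ge0. Qed.

Lemma incr20 f : incr2 f 0 = 0.
Proof. by apply: big1 => a _; rewrite subr0 subrr expr0n. Qed.

Lemma incr2N f v : incr2 f (- v) = incr2 f v.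
Proof.
rewrite /incr2 -[LHS](sum_shift _ (- v)); apply: eq_bigr => a _.
by rewrite opprK subrK -(opprB (f a)) sqrrN.
Qed.

Lemma incr2D (e : R) f u v : 0 < e ->
  incr2 f (u + v) <= (1 + e) * incr2 f u + (1 + e^-1) * incr2 f v.
Proof.
move=> e0; rewrite /incr2 -[X in _ + _ * X](sum_shift _ (- u)) !mulr_sumr -big_split /=.
apply: ler_sum => a _; rewrite opprD addrA.
set x := f a; set y := f (a - u); set z := f _.
rewrite -subr_ge0 (_ : _ - _ = e * (x - y - e^-1 * (y - z)) ^+ 2); last first.
  by field; rewrite gt_eqF.
by rewrite mulr_ge0 ?sqr_ge0 // ltW.
Qed.

Lemma incr2_sum f (us : seq V) :
  incr2 f (\sum_(u <- us) u) <= (size us)%:R * \sum_(u <- us) incr2 f u.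
Proof.
elim: us => [|u us IH]; first by rewrite !big_nil incr20 mulr0.
case: us IH => [|u' us] IH; first by rewrite !big_cons !big_nil !addr0 mul1r.
rewrite big_cons [X in _ <= _ * X]big_cons; move: IH.
set S := \sum_(w <- u' :: us) w; set T := \sum_(w <- u' :: us) incr2 f w => IH.
set n := size (u' :: us) in IH *; have n0 : 0 < n%:R :> R by rewrite ltr0n.
(* The weight [e = n] makes both coefficients of the weighted triangle inequality come out as
   [n + 1]. *)
apply: le_trans (incr2D f u S n0) _.
rewrite (_ : size [:: u, u' & us] = n.+1) // -natr1.
have : (1 + n%:R^-1) * incr2 f S <= (1 + n%:R^-1) * (n%:R * T).
  by rewrite ler_wpM2l // addr_ge0 // invr_ge0 ltW.
have -> : (1 + n%:R^-1) * (n%:R * T) = (n%:R + 1) * T by field; rewrite gt_eqF.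
have := incr2_ge0 f u; lra.
Qed.

Lemma incr2Mn f u n : incr2 f (u *+ n) <= n%:R ^+ 2 * incr2 f u.
Proof.
have := incr2_sum f (nseq n u).
by rewrite !big_nseq !iter_addr_0 size_nseq expr2 -mulrA [_%:R * incr2 f u]mulr_natl.
Qed.

Lemma incr2Mz f u (k : int) : incr2 f (u *~ k) <= k%:~R ^+ 2 * incr2 f u.
Proof.
case: (intP k) => [|n|n].
- by rewrite mulr0z incr20 expr0n mul0r.
- by rewrite -pmulrn; apply: incr2Mn.
- by rewrite mulrNz incr2N rmorphN sqrrN -pmulrn; apply: incr2Mn.
Qed.

Lemma cauchy_schwarz f h : 0 < corr f 0 ->
  (\sum_a f a * h a) ^+ 2 <= corr f 0 * corr h 0.
Proof.
rewrite !corr0; set A := \sum_a _ ^+ 2; set B := \sum_a _ * _; set C := \sum_a h a ^+ 2 => A0.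
have : 0 <= \sum_a (B * f a - A * h a) ^+ 2 by apply: sumr_ge0 => a _; apply: sqr_ge0.
have -> : \sum_a (B * f a - A * h a) ^+ 2 = A * (A * C - B ^+ 2).
  transitivity (\sum_a (B ^+ 2 * f a ^+ 2 - 2 * A * B * (f a * h a) + A ^+ 2 * h a ^+ 2)).
    by apply: eq_bigr => a _; ring.
  by rewrite big_split sumrB /= -!mulr_sumr -/A -/B -/C; ring.
by rewrite pmulr_rge0 // subr_ge0.
Qed.

Lemma avg_step_adj g f h : \sum_a avg_step g f a * h a = \sum_a f a * avg_step g h a.
Proof.
transitivity (\sum_a (f (a - g) * h a + f (a + g) * h a) / 2).
  by apply: eq_bigr => a _; rewrite /avg_step; lra.
rewrite -mulr_suml big_split /= -(sum_shift (fun a => f (a - g) * h a) g).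
rewrite -(sum_shift (fun a => f (a + g) * h a) (- g)) -big_split /= mulr_suml.
by apply: eq_bigr => a _; rewrite addrK subrK /avg_step; lra.
Qed.

(** Together with [corr_incr2]: one step [g] lowers the squared norm by exactly a quarter of
    [incr2 f (g *+ 2)], so slow decay of the norm means flatness along [g *+ 2]. *)
Lemma corr_avg_step g f : corr (avg_step g f) 0 = (corr f 0 + corr f (g *+ 2)) / 2.
Proof.
rewrite corr0 corr0.
transitivity (\sum_a (f (a - g) ^+ 2 + f (a + g) ^+ 2 + 2 * (f (a + g) * f (a - g))) / 4).
  by apply: eq_bigr => a _; rewrite /avg_step; field.
rewrite -mulr_suml !big_split /= (sum_shift (fun a => f a ^+ 2)).
rewrite (sum_shift (fun a => f a ^+ 2)) -mulr_sumr.
rewrite (_ : \sum_a f (a + g) * _ = corr f (g *+ 2)); first by lra.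
rewrite -(sum_shift _ (- g)); apply: eq_bigr => a _.
by rewrite subrK mulr2n opprD addrA.
Qed.

(** The squared distance to the uniform law is nonnegative. *)
Lemma corr_walk_gt0 s : (#|V|%:R)^-1 <= corr (walk s) 0.
Proof.
have V0 : (0 : R) < #|V|%:R by rewrite ltr0n; apply/card_gt0P; exists 0.
rewrite -[leLHS]mul1r ler_pdivrMr // corr0 mulr_suml.
set A := \sum_i _.
have : 0 <= \sum_(v : V) (walk s v - #|V|%:R^-1) ^+ 2 * #|V|%:R.
  by apply: sumr_ge0 => a _; rewrite mulr_ge0 ?sqr_ge0 // ltW.
rewrite (_ : \sum_v _ = A - 1); first by rewrite subr_ge0.
transitivity (\sum_v (walk s v ^+ 2 * #|V|%:R - 2 * walk s v + #|V|%:R^-1)).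
  by apply: eq_bigr => a _; field; rewrite gt_eqF.
rewrite big_split sumrB /= -mulr_sumr -/A sum_walk sumr_const.
rewrite (_ : #|V|%:R^-1 *+ _ = 1); first by lra.
by rewrite -[LHS]mulr_natl mulfV ?gt_eqF.
Qed.

Lemma corr_walk_le1 s : corr (walk s) 0 <= 1.
Proof.
rewrite corr0 -(sum_walk s); apply: ler_sum => v _.
by rewrite expr2 ler_piMl ?walk_ge0 ?walk_le1.
Qed.

(* The return probabilities [a i] of the walk with [i] pairs of steps [g] are
   log-convex in [i], so [a h <= rho ^+ h] where [rho := a h.+1 / a h], while
   [1 / #|V| <= a h]: the ratio [rho] is within [ln #|V| / h] of 1. *)
Lemma incr2_walk g s (h : nat) : (0 < h)%N ->
  incr2 (walk (nseq h g ++ s)) (g *+ 2) <=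
  4 * (ln #|V|%:R / h%:R) * corr (walk (nseq h g ++ s)) 0.
Proof.
move=> h0.
have V0 : (0 : R) < #|V|%:R by rewrite ltr0n; apply/card_gt0P; exists 0.
pose f i := walk (nseq i g ++ s).
have fS i : f i.+1 = avg_step g (f i) by [].
pose a i := corr (f i) 0.
have a0 i : 0 < a i by apply: lt_le_trans (corr_walk_gt0 _); rewrite invr_gt0.
(* Steps are self-adjoint, so the squared norm of [f i.+1] is the inner product of [f i] and
   [f i.+2]; Cauchy-Schwarz finishes. *)
have logconv i : a i.+1 / a i <= a i.+2 / a i.+1.
  rewrite ler_pdivrMr // mulrAC ler_pdivlMr // -expr2 mulrC.
  rewrite {1}/a corr0 (_ : \sum_x _ = \sum_x f i x * f i.+2 x).
    by apply: cauchy_schwarz; apply: a0.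
  by rewrite [in RHS]fS -avg_step_adj -fS; apply: eq_bigr => x _; rewrite expr2.
pose rho := a h.+1 / a h.
have rho0 : 0 < rho by rewrite divr_gt0.
have rhoM i : (i <= h)%N -> a i.+1 / a i <= rho.
  move=> ih; rewrite /rho -(subnKC ih); elim: (h - i)%N => [|j IH]; first by rewrite addn0.
  by apply: le_trans IH _; rewrite addnS; apply: logconv.
have ah i : (i <= h)%N -> a i <= rho ^+ i.
  elim: i => [|i IH] ih; first exact: corr_walk_le1.
  rewrite -[a i.+1](divfK (lt0r_neq0 (a0 i))) exprS; apply: ler_pM.
  - by rewrite divr_ge0 // ltW.
  - exact: ltW.
  - exact/rhoM/ltnW.
  - exact/IH/ltnW.
have rhoh : #|V|%:R^-1 <= rho ^+ h by apply: le_trans (ah h (leqnn h)); apply: corr_walk_gt0.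
have rho1 : 1 - rho <= ln #|V|%:R / h%:R.
  rewrite ler_pdivlMr ?ltr0n // -lerN2 -lnV ?posrE // mulrC -mulrN opprB.
  apply: le_trans (_ : ln (rho ^+ h) <= _).
    by rewrite ler_ln ?posrE ?invr_gt0 ?exprn_gt0.
  rewrite lnXn // -[X in X <= _]mulr_natl ler_wpM2l //.
  have := @le_ln1Dx R (rho - 1); rewrite [1 + _]addrC subrK; apply; lra.
have := corr_incr2 (f h) (g *+ 2); have := corr_avg_step g (f h).
rewrite -fS -/(a h) -/(a h.+1) => eq1 eq2.
have -> : incr2 (walk (nseq h g ++ s)) (g *+ 2) = 4 * (a h - a h.+1).
  by move: eq1 eq2; rewrite -/(f h); lra.
rewrite -mulrA ler_pM2l // (_ : a h - a h.+1 = (1 - rho) * a h); last first.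
  by rewrite /rho mulrBl divfK ?gt_eqF // mul1r.
by rewrite ler_pM2r.
Qed.

(* The integer vectors are kept apart from their images in [V] so that halving
   the displacement makes sense. *)
Section Lattice.
Variables (I : finType) (e : I -> V) (s : seq V) (Q : R).
Definition emb (z : {ffun I -> int}) : V := \sum_i e i *~ z i.
Definition sqnorm (z : {ffun I -> int}) : R := \sum_i (z i)%:~R ^+ 2.

Lemma emb_is_zmod_morphism : zmod_morphism emb.
Proof.
by move=> y z; rewrite /emb -sumrB; apply: eq_bigr => i _; rewrite !ffunE mulrzBr.
Qed.
HB.instance Definition _ := GRing.isZmodMorphism.Build _ _ emb emb_is_zmod_morphism.

Lemma sqnormDB y z : sqnorm (y - z) + sqnorm (y + z) = 2 * (sqnorm y + sqnorm z).
Proof.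
rewrite /sqnorm -!big_split mulr_sumr /=; apply: eq_bigr => i _.
rewrite !ffunE rmorphB rmorphD /=; ring.
Qed.

Hypothesis incr2Q : forall i, incr2 (walk s) (e i *+ 2) <= Q.

(** [k + k] is a combination of the vectors [e i *+ 2], along which [Q] bounds the increments. The 8
    is 2 from [corr_incr2] times 4 from the squared norm of [k + k]. *)
Lemma walk_even (k : {ffun I -> int}) :
  corr (walk s) 0 - (#|I|%:R * Q / 8) * sqnorm (k + k) <= walk (s ++ s) (emb (k + k)).
Proof.
rewrite walk_corr -[corr _ (emb _)](subKr (corr (walk s) 0)) lerB // corr_incr2.
have -> : emb (k + k) = \sum_(u <- [seq e i *+ 2 *~ k i | i <- enum I]) u.
  rewrite big_map big_enum /= raddfD /= /emb -big_split /=; apply: eq_bigr => i _.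
  by rewrite mulr2n mulrzDl.
set us := map _ _; have sus : size us = #|I| by rewrite size_map -cardE.
apply: le_trans (_ : #|I|%:R * (\sum_i (k i)%:~R ^+ 2 * Q) / 2 <= _).
  rewrite ler_wpM2r //; apply: le_trans (incr2_sum _ _) _.
  rewrite sus ler_wpM2l // /us big_map big_enum /=; apply: ler_sum => i _.
  by apply: le_trans (incr2Mz _ _ _) _; rewrite ler_wpM2l ?sqr_ge0.
rewrite le_eqVlt; apply/orP; left; apply/eqP.
rewrite /sqnorm !mulr_sumr mulr_suml; apply: eq_bigr => i _.
by rewrite !ffunE rmorphD /=; field.
Qed.

(** Averaging over [z - t] and [z + t] raises the mean squared norm by exactly [sqnorm t], by the
    parallelogram law, so the loss is linear in the number of remaining steps. The parity condition
    survives because the two points differ by [t + t]. *)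
Lemma walk_lower (rest : seq {ffun I -> int}) (z k : {ffun I -> int}) :
  z + \sum_(t <- rest) t = k + k ->
  corr (walk s) 0 - (#|I|%:R * Q / 8) * (sqnorm z + \sum_(t <- rest) sqnorm t) <=
  walk (map emb rest ++ (s ++ s)) (emb z).
Proof.
elim: rest z k => [|t rest IH] z k.
  by rewrite !big_nil !addr0 => ->; apply: walk_even.
rewrite !big_cons /= => h; rewrite /avg_step -raddfB -raddfD.
have h1 : (z + t) + \sum_(t <- rest) t = k + k by rewrite -addrA.
have h2 : (z - t) + \sum_(t <- rest) t = (k - t) + (k - t).
  move: h; move: (\sum_(_ <- rest) _) => S h.
  apply/ffunP => i; move: (congr1 (fun f : {ffun I -> int} => f i) h).
  rewrite !ffunE; move: (z i) (t i) (S i) (k i); clear; move=> a b c d; lia.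
have := IH _ _ h1; have := IH _ _ h2; have := sqnormDB z t.
set C := #|I|%:R * Q / 8; set S := \sum_(_ <- _) _.
move: (sqnorm (z - t)) (sqnorm (z + t)) (sqnorm z) (sqnorm t) => a b c d e1 h3 h4.
have e2 : C * a + C * b = 2 * (C * c + C * d) by rewrite -mulrDr e1; ring.
move: h3 h4; rewrite !mulrDr; lra.
Qed.

Lemma walk_upper (rest : seq V) v : walk (rest ++ (s ++ s)) v <= corr (walk s) 0.
Proof.
rewrite walk_cat.
apply: le_trans (_ : \sum_a walk rest (v - a) * corr (walk s) 0 <= _).
  apply: ler_sum => a _; rewrite mulrC ler_wpM2l ?walk_ge0 // walk_corr; exact: corr_le.
rewrite -mulr_suml (_ : \sum_a _ = 1) ?mul1r //.
rewrite -(sum_walk rest) [RHS](reindex_inj (@addrI _ v)) /=.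
by rewrite [RHS](reindex_inj (@oppr_inj _)).
Qed.

End Lattice.
End Walk.

(** * Common neighbours of a tuple of vertices *)

HB.saturate finfun_of.

Lemma ffunMzE (aT : finType) (rT : zmodType) (f : {ffun aT -> rT}) (k : int) x :
  (f *~ k) x = f x *~ k.
Proof. by case: k => n; rewrite ?NegzE ?mulrNz ?ffunE -!pmulrn ffunMnE. Qed.

Lemma intr_Zp_eq0 (M : nat) (k : int) : (1 < M)%N -> (`|k| < M)%N ->
  ((k%:~R : 'Z_M) == 0) = (k == 0).
Proof.
move=> M1 kM; apply/eqP/eqP => [|->]; last by rewrite mulr0z.
have h a : (a < M)%N -> (a%:R : 'Z_M) = 0 -> a = 0%N.
  by move=> aM /(congr1 val) /=; rewrite val_Zp_nat // modn_small.
case: (intP k) kM => [//|a|a] kM.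
  by rewrite -pmulrn => /h -> //; move: kM.
rewrite mulrNz => /eqP; rewrite oppr_eq0 -pmulrn => /eqP/h -> //.
Qed.

(** [y] is the set of steps taken with sign plus: the subsets of [ts] are the equally likely sign
    patterns. *)
Lemma walk_count (R : realType) (T : finType) (V : finZmodType) (f : T -> V) (ts : seq T) v :
  uniq ts ->
  2 ^+ size ts * walk R (map f ts) v =
  #|[set y : {set T} | (y \subset [set t in ts]) &&
     (\sum_(t <- ts) (if t \in y then f t else - f t) == v)]|%:R.
Proof.
elim: ts v => [|t ts IH] v /=.
  rewrite expr0 mul1r => _; case: eqVneq => [->|v0] /=.
    rewrite -(cards1 (set0 : {set T})); congr (_%:R); apply: eq_card => y.
    rewrite !inE big_nil eqxx andbT -subset0.
    by rewrite (_ : [set t in [::]] = set0) //; apply/setP => t; rewrite !inE.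
  rewrite -(cards0 {set T}); congr (_%:R); apply: eq_card => y.
  by rewrite !inE big_nil eq_sym (negbTE v0) andbF.
case/andP => tts uts; rewrite /avg_step.
have sumE (y : {set T}) : \sum_(t' <- ts) (if t' \in t |: y then f t' else - f t') =
    \sum_(t' <- ts) (if t' \in y then f t' else - f t').
  apply: eq_big_seq => t' t'ts; rewrite !inE; case: eqVneq => // e.
  by rewrite -e t'ts in tts.
rewrite exprS (_ : 2 * 2 ^+ size ts * _ = 2 ^+ size ts * walk R (map f ts) (v - f t) +
   2 ^+ size ts * walk R (map f ts) (v + f t)); last by field.
rewrite !IH // -natrD; congr _%:R.
rewrite -[RHS](cardsID [set y : {set T} | t \in y]); congr (_ + _)%N.
- rewrite -(card_in_imset (f := fun y => t |: y)); last first.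
    move=> y z; rewrite !inE => /andP[/subsetP yS _] /andP[/subsetP zS _] e.
    have ty (u : {set T}) : {subset u <= [set t0 in ts]} -> t \notin u.
      by move=> us; apply/negP => /us; rewrite inE (negbTE tts).
    by rewrite -(setU1K (ty _ yS)) -(setU1K (ty _ zS)) e.
  apply: eq_card => y; apply/imsetP/idP => [[z]|].
    rewrite !inE => /andP[zS /eqP sz] ->.
    rewrite !inE big_cons setU11 sumE sz addrC subrK !eqxx /= !andbT.
    apply/subsetP => u; rewrite !inE => /orP[->//|uz].
    by have /subsetP/(_ u uz) := zS; rewrite inE => ->; rewrite orbT.
  rewrite !inE big_cons => /andP[/andP[yS /eqP sy] ty]; rewrite ty in sy.
  exists (y :\ t); last by rewrite setD1K.
  rewrite !inE -sumE setD1K // -sy [f t + _]addrC addrK eqxx andbT.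
  apply/subsetP => u; rewrite !inE => /andP[ut uy].
  by have /subsetP/(_ u uy) := yS; rewrite !inE (negbTE ut).
- apply: eq_card => y; rewrite !inE big_cons.
  case: (boolP (t \in y)) => ty /=.
    apply/negbTE; rewrite negb_and; apply/orP; left.
    by apply/negP => /subsetP/(_ t ty); rewrite inE (negbTE tts).
  rewrite (addrC (- f t)) subr_eq; congr (_ && _).
  apply/subsetP/subsetP => h u uy; have := h u uy; rewrite !inE; first by move=> ->; rewrite orbT.
  by case/orP => // /eqP e; rewrite e (negbTE ty) in uy.
Qed.

Section Star.
Variables (R : realType) (n d M : nat).
Implicit Types (x : 'I_d -> {set 'I_n}) (J w : {set 'I_d}).

(** [x] lists all vertices placed so far and [J] those to which the new one must be joined. With the
    whole tuple kept, the cells, and hence the exceptional tuples, do not depend on [J]. *)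
Definition star x J : {set {set 'I_n}} :=
  [set y in Vtx n | [forall j in J, #|x j :&: y| == (n %/ 4)%N]].

Definition cell x (t : 'I_n) : {set 'I_d} := [set j | t \in x j].

(* With [u t = 1] if [t \in y] and [- 1] otherwise, [y] lies in [star x J] iff the
   sum of [u t] times the indicator of [t \in x j] vanishes for all [j \in J], and
   so does the sum of [u t]. The [None] coordinate is chosen so that the cells
   [set0] and [[set j]] give the standard basis. *)
Definition cellvec J w : {ffun option 'I_d -> int} :=
  [ffun i => if i is Some j then ((j \in w) && (j \in J))%:Z else 1 - #|w :&: J|%:Z].

(** For [j] outside [J] the generator is 0: no cell supplies that basis vector, and [incr2_core]
    must hold for every index. *)
Definition unitvec (J : {set 'I_d}) (i : option 'I_d) : {ffun option 'I_d -> 'Z_M} :=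
  if (if i is Some j then j \in J else true) then [ffun i' => (i' == i)%:R] else 0.

Definition unitcell (i : option 'I_d) : {set 'I_d} := if i is Some j then [set j] else set0.

Lemma embE J (z : {ffun option 'I_d -> int}) : (forall j, j \notin J -> z (Some j) = 0) ->
  emb (unitvec J) z = [ffun i => (z i)%:~R].
Proof.
move=> z0; apply/ffunP => i; rewrite /emb sum_ffunE ffunE.
rewrite (bigD1 i) //= big1 ?addr0.
  rewrite ffunMzE /unitvec; case: ifP => ci; first by rewrite ffunE eqxx.
  by case: i ci => // j jJ; rewrite z0 ?jJ // !mulr0z.
move=> i' i'i; rewrite ffunMzE /unitvec; case: ifP => _.
  by rewrite ffunE eq_sym (negbTE i'i) mul0rz.
by rewrite ffunE mul0rz.
Qed.

Lemma emb_unitcell J i : (if i is Some j then j \in J else true) ->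
  emb (unitvec J) (cellvec J (unitcell i)) = unitvec J i.
Proof.
move=> ci; rewrite embE; last by move=> j jJ; rewrite ffunE (negbTE jJ) andbF.
apply/ffunP => i'; rewrite /unitvec ci !ffunE.
case: i ci => [j jJ|_]; case: i' => [j'|] //=.
- rewrite inE; have [->|jj] := eqVneq j' j; first by rewrite jJ eqxx.
  by rewrite (_ : (Some j' == Some j) = false) //; apply/eqP => -[e]; rewrite e eqxx in jj.
- by rewrite (setIidPl _) ?sub1set // cards1 subrr.
- by rewrite inE.
- by rewrite set0I cards0 subr0.
Qed.

Lemma sqnorm_cellvec J w : sqnorm R (cellvec J w) <= (d.+1 ^ 2)%:R.
Proof.
have cI : \sum_(j : 'I_d) (j \in w :&: J)%:R = #|w :&: J|%:R :> R.
  by rewrite -sum1_card natr_sum [RHS]big_mkcond /=; apply: eq_bigr => j _; case: ifP.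
have -> : sqnorm R (cellvec J w) = (1 - #|w :&: J|%:R) ^+ 2 + #|w :&: J|%:R.
  rewrite /sqnorm (bigD1 None) //= ffunE rmorphB /=; congr (_ + _).
  rewrite -cI (reindex_omap Some id) /=; last by case.
  apply: eq_big => [j|j _]; first by rewrite eqxx.
  by rewrite ffunE inE; case: (_ && _); rewrite /= ?expr1n ?expr0n.
have : (#|w :&: J| <= d)%N by rewrite -[leqRHS]card_ord; apply: max_card.
move: #|_| => q qd; rewrite natrX -natr1.
have : q%:R <= d%:R :> R by rewrite ler_nat.
have : 0 <= q%:R :> R by [].
move: (q%:R : R) (d%:R : R) => a b a0 ab.
have : 0 <= (b - a) * (b + a) by rewrite mulr_ge0; lra.
lra.
Qed.

Definition signed_sum x J (y : {set 'I_n}) : {ffun option 'I_d -> int} :=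
  \sum_(t <- enum 'I_n) (if t \in y then cellvec J (cell x t) else - cellvec J (cell x t)).

Lemma sum_sign (A y : {set 'I_n}) :
  \sum_(t <- enum 'I_n) (if t \in y then (t \in A)%:Z else - (t \in A)%:Z) =
  2 * #|A :&: y|%:Z - #|A|%:Z.
Proof.
have card_sum (B : {set 'I_n}) : \sum_(t : 'I_n) (t \in B)%:Z = #|B|%:Z.
  by rewrite -sum1_card -natz natr_sum [RHS]big_mkcond /=; apply: eq_bigr => j _; case: ifP.
rewrite big_enum /= -!card_sum mulr_sumr -sumrB; apply: eq_bigr => t _.
by rewrite inE; case: (t \in A); case: (t \in y); rewrite /=; lia.
Qed.

Lemma signed_sum_Some x J y j : signed_sum x J y (Some j) =
  if j \in J then 2 * #|x j :&: y|%:Z - #|x j|%:Z else 0.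
Proof.
rewrite /signed_sum sum_ffunE; case: ifP => jJ.
  rewrite -sum_sign; apply: eq_bigr => t _.
  by case: ifP => _; rewrite !ffunE inE jJ andbT.
by apply: big1 => t _; case: ifP => _; rewrite !ffunE jJ andbF ?oppr0.
Qed.

Lemma card_cell x J t : #|cell x t :&: J|%:Z = \sum_(j in J) (t \in x j)%:Z.
Proof.
rewrite -sum1_card -natz natr_sum big_mkcond [RHS]big_mkcond /=; apply: eq_bigr => j _.
by rewrite !inE; case: (j \in J); case: (t \in x j).
Qed.

Lemma signed_sum_None x J y : signed_sum x J y None =
  2 * #|y|%:Z - n%:Z - \sum_(j in J) (2 * #|x j :&: y|%:Z - #|x j|%:Z).
Proof.
under [X in _ - X]eq_bigr do rewrite -sum_sign.
rewrite exchange_big /= /signed_sum sum_ffunE.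
have := sum_sign setT y; rewrite setTI cardsT card_ord => <-.
rewrite -sumrB; apply: eq_bigr => t _.
rewrite inE; case: (t \in y); rewrite !ffunE card_cell // sumrN.
by rewrite opprB opprK addrC.
Qed.

Lemma signed_sum_bound x J y i : (`|signed_sum x J y i| <= n * d.+1)%N.
Proof.
rewrite /signed_sum sum_ffunE big_enum /=.
have : `|\sum_(t : 'I_n) (if t \in y then cellvec J (cell x t) else - cellvec J (cell x t)) i|
   <= \sum_(t : 'I_n) d.+1%:Z.
  apply: le_trans (ler_norm_sum _ _ _) _; apply: ler_sum => t _.
  have cd : (#|cell x t :&: J| <= d)%N by rewrite -[leqRHS]card_ord; apply: max_card.
  have : `|cellvec J (cell x t) i| <= d.+1%:Z.
    rewrite ffunE; case: i => [j|]; first by case: (_ && _).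
    by move: cd; lia.
  by case: ifP => _; rewrite ?ffunE ?normrN.
rewrite sumr_const card_ord -mulr_natr natz; move: (\sum_(_ < _) _) => z; lia.
Qed.

Lemma signed_sum_eq0 m x J y : n = (4 * m)%N -> (forall j, j \in J -> x j \in Vtx n) ->
  (signed_sum x J y == 0) = (y \in star x J).
Proof.
move=> nm xV.
have xc j : j \in J -> #|x j| = (2 * m)%N.
  by move=> /xV; rewrite inE => /eqP ->; lia.
rewrite !inE; apply/eqP/andP => [z0|[/eqP cy /forall_inP yJ]].
- have zj j : j \in J -> 2 * #|x j :&: y|%:Z - #|x j|%:Z = 0.
    by move=> jJ; have := signed_sum_Some x J y j; rewrite jJ z0 ffunE.
  have := signed_sum_None x J y; rewrite z0 ffunE big1 // => zN.
  split; first by apply/eqP; move: zN; lia.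
  by apply/forall_inP => j jJ; have := zj j jJ; rewrite xc //; lia.
- apply/ffunP => i; rewrite ffunE.
  have zj j : j \in J -> 2 * #|x j :&: y|%:Z - #|x j|%:Z = 0.
    by move=> jJ; have /eqP := yJ j jJ; rewrite xc //; lia.
  case: i => [j|]; first by rewrite signed_sum_Some; case: ifP => // /zj.
  by rewrite signed_sum_None big1 //; lia.
Qed.

(** [M] exceeds every coordinate of [signed_sum], so a sum vanishing modulo [M] vanishes over the
    integers and encodes membership in the star. *)
Lemma star_walk m x J : n = (4 * m)%N -> (n * d.+1 < M)%N -> (1 < M)%N ->
  (forall j, j \in J -> x j \in Vtx n) ->
  #|star x J|%:R = 2 ^+ n * walk R [seq emb (unitvec J) (cellvec J (cell x t)) | t <- enum 'I_n] 0.
Proof.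
move=> nm nM M1 xV.
have := @walk_count R _ _ (fun t => emb (unitvec J) (cellvec J (cell x t))) _ 0 (enum_uniq 'I_n).
rewrite size_enum_ord => ->.
congr _%:R; apply: eq_card => y; rewrite -(signed_sum_eq0 y nm xV) inE.
rewrite (_ : y \subset _); last by apply/subsetP => t _; rewrite inE mem_enum.
have -> : \sum_(t <- enum 'I_n) (if t \in y then emb (unitvec J) (cellvec J (cell x t))
   else - emb (unitvec J) (cellvec J (cell x t))) = emb (unitvec J) (signed_sum x J y).
  rewrite /signed_sum raddf_sum; apply: eq_bigr => t _; case: ifP => // _.
  by rewrite raddfN.
rewrite embE /=; last by move=> j jJ; rewrite signed_sum_Some (negbTE jJ).
apply/eqP/eqP => [->|/ffunP h].
  by apply/ffunP => i; rewrite !ffunE.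
apply/ffunP => i; have := h i; rewrite !ffunE => /eqP.
rewrite intr_Zp_eq0 // => [/eqP //|].
exact: leq_ltn_trans (signed_sum_bound _ _ _ _) nM.
Qed.

End Star.

Lemma card_subsets (T : finType) : #|{set T}| = (2 ^ #|T|)%N.
Proof. by rewrite -(cardsT {set T}) -powersetT card_powerset cardsT. Qed.

Section HalfCore.
Variables (T : finType) (h : nat).

(** Every cell [h] times; the comparison of return probabilities uses two copies of this list. *)
Definition half_core : seq T := flatten [seq nseq h w | w <- enum T].

Lemma half_core_perm w :
  perm_eq half_core (nseq h w ++ flatten [seq nseq h w | w <- rem w (enum T)]).
Proof.
rewrite -[X in perm_eq _ X]/(flatten [seq nseq h w | w <- w :: rem w (enum T)]).
by apply/perm_flatten/perm_map/perm_to_rem; rewrite mem_enum.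
Qed.

Lemma size_half_core : size half_core = (#|T| * h)%N.
Proof.
rewrite size_flatten /shape -map_comp (eq_map (g := fun=> h)); last by move=> w /=; rewrite size_nseq.
by rewrite sumnE big_map big_enum sum_nat_const.
Qed.

Lemma count_half_core w : count_mem w half_core = h.
Proof.
rewrite (seq.permP (half_core_perm w)) count_cat count_nseq /= eqxx mul1n count_flatten.
rewrite -map_comp sumnE big_map big1_seq ?addn0 // => u /andP[_].
rewrite mem_rem_uniq ?enum_uniq // inE => /andP[uw _].
by rewrite /= count_nseq /= (negbTE uw) mul0n.
Qed.

End HalfCore.

Lemma ler_sum_size (R : realType) (T : Type) (s : seq T) (F : T -> R) (c : R) :
  (forall t, F t <= c) -> \sum_(t <- s) F t <= (size s)%:R * c.
Proof.
move=> Fc; elim: s => [|t s IH]; first by rewrite big_nil mul0r.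
by rewrite big_cons /= -natr1 mulrDl mul1r addrC lerD.
Qed.

Section StarBounds.
Variables (R : realType) (n d M : nat).
Implicit Types (x : 'I_d -> {set 'I_n}) (J w : {set 'I_d}) (h : nat).

Definition core J h := [seq emb (unitvec M J) (cellvec J w) | w <- half_core {set 'I_d} h].

Definition spread h x := forall w, (2 * h <= #|[set t | cell x t == w]|)%N.

(** Free of [x]: this is the common value near which all spread tuples have their number of common
    neighbours. *)
Definition star_max J h : R := 2 ^+ n * corr (walk R (core J h)) 0.

(** From [walk_lower] with [d + 1] generators, [Q] equal to [4 * (d + 1) * ln M / h] times the
    return probability, and squared norm at most [(d + 1) ^ 2] for each step outside the doubled
    core. *)
Definition star_err h : R :=
  (d.+1 ^ 4)%:R / 2 * (n - 2 ^ d * (2 * h))%:R * (ln M%:R / h%:R).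

(** The core contains [h] steps equal to each nonzero generator; permuted to the front, they allow
    [incr2_walk]. The factor [d + 1] is the logarithm of the group order divided by [ln M]. *)
Lemma incr2_core J h i : (0 < h)%N -> (1 < M)%N ->
  incr2 (walk R (core J h)) (unitvec M J i *+ 2) <=
  4 * (d.+1%:R * ln M%:R / h%:R) * corr (walk R (core J h)) 0.
Proof.
move=> h0 M1.
have cV : ln #|{ffun option 'I_d -> 'Z_M}|%:R = d.+1%:R * ln M%:R :> R.
  rewrite card_ffun card_option !card_ord Zp_cast // natrX lnXn ?ltr0n ?(ltnW M1) //.
  by rewrite [RHS]mulr_natl.
case ci : (if i is Some j then j \in J else true); last first.
  rewrite /unitvec ci mul0rn incr20 mulr_ge0 //; last first.
    by apply: le_trans (corr_walk_gt0 _ _); rewrite invr_ge0.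
  by rewrite mulr_ge0 // divr_ge0 // mulr_ge0 // ln_ge0 // ler1n ltnW.
rewrite -(emb_unitcell M ci) -cV.
have pc := perm_map (fun w => emb (unitvec M J) (cellvec J w)) (half_core_perm h (unitcell i)).
rewrite map_cat map_nseq in pc.
have -> : walk R (core J h) = walk R (nseq h (emb (unitvec M J) (cellvec J (unitcell i))) ++
   map (fun w => emb (unitvec M J) (cellvec J w))
    (flatten [seq nseq h w0 | w0 <- rem (unitcell i) (enum {set 'I_d})])).
  by apply/funext; apply: walk_perm.
exact: incr2_walk.
Qed.

(** The walk depends only on the multiset of cells, which for a spread tuple contains [half_core]
    twice. The upper bound is free of error because the law of the doubled core is largest at 0. *)
Lemma star_bounds m x J h : n = (4 * m)%N -> (n * d.+1 < M)%N -> (1 < M)%N -> (0 < h)%N ->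
  (forall j, j \in J -> x j \in Vtx n) -> spread h x ->
  star_max J h * (1 - star_err h) <= #|star x J|%:R <= star_max J h.
Proof.
move=> nm nM M1 h0 xV xs.
rewrite (star_walk R nm nM M1 xV).
have [rest prest] : exists rest, perm_eq [seq cell x t | t <- enum 'I_n]
    (rest ++ (half_core {set 'I_d} h ++ half_core {set 'I_d} h)).
  have /count_subseqP[s' ss' ps'] : forall w,
    (count_mem w (half_core {set 'I_d} h ++ half_core {set 'I_d} h) <=
     count_mem w [seq cell x t | t <- enum 'I_n])%N.
    move=> w; rewrite count_cat !count_half_core addnn -mul2n.
    apply: leq_trans (xs w) _; rewrite count_map -size_filter cardE.
    rewrite /enum_mem size_filter size_filter; apply: eq_leq.
    rewrite count_filter; apply: eq_count => t /=.
    by rewrite !inE /= andbT.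
  have [rest pr] := perm_to_subseq ss'.
  exists rest; rewrite perm_sym perm_catC; apply: perm_trans (_ : perm_eq (s' ++ rest) _).
    by rewrite perm_cat2r.
  by rewrite perm_sym.
pose f w := emb (unitvec M J) (cellvec J w).
have -> : walk R [seq f (cell x t) | t <- enum 'I_n] 0 =
    walk R (map (emb (unitvec M J)) (map (cellvec J) rest) ++ (core J h ++ core J h)) 0.
  apply: walk_perm; have := perm_map f prest.
  by rewrite -!map_comp !map_cat.
apply/andP; split; last first.
  by rewrite /star_max ler_wpM2l ?exprn_ge0 //; apply: walk_upper.
rewrite /star_max -mulrA ler_wpM2l ?exprn_ge0 //.
(* Over all [t] the cell vectors sum to [2m] at each [j] in [J], 0 at the other [j], and
   [4m - 2m #|J|] at [None], all even; removing twice the half core keeps the sum even. *)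
have [k ek] : exists k : {ffun option 'I_d -> int}, \sum_(t <- map (cellvec J) rest) t = k + k.
  exists ([ffun i => if i is Some j then (if j \in J then m%:Z else 0)
     else 2 * m%:Z - m%:Z * #|J|%:Z] - \sum_(w <- half_core {set 'I_d} h) cellvec J w).
  have e1 : signed_sum x J setT = \sum_(w <- map (cellvec J) rest) w +
    (\sum_(w <- half_core {set 'I_d} h) cellvec J w + \sum_(w <- half_core {set 'I_d} h) cellvec J w).
    rewrite big_map -!big_cat /= -(perm_big _ prest) big_map /signed_sum.
    by apply: eq_bigr => t _; rewrite inE.
  move: e1; move: (\sum_(w <- half_core _ _) _) (\sum_(w <- map _ _) _) => S1 S2 /ffunP e1.
  apply/ffunP => i; have := e1 i; rewrite !ffunE.
  have xc j : j \in J -> #|x j| = (2 * m)%N.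
    by move=> /xV; rewrite inE => /eqP ->; lia.
  have -> : signed_sum x J setT i = (if i is Some j then (if j \in J then (2 * m)%:Z else 0)
     else (4 * m)%:Z - (2 * m)%:Z * #|J|%:Z).
    case: i => [j|].
      by rewrite signed_sum_Some setIT; case: ifP => // jJ; rewrite xc //; lia.
    rewrite signed_sum_None cardsT card_ord (eq_bigr (fun=> (2 * m)%:Z)); last first.
      by move=> j jJ; rewrite setIT xc //; lia.
    rewrite sumr_const -mulr_natr natz; lia.
  move: (S1 i) (S2 i); clear; case: i => [j|] b c; first by case: ifP => _; lia.
  move: m #|J|%N b c => u v b c; rewrite !PoszM; lia.
set c0 := corr _ 0.
have Q i := incr2_core J i h0 M1.
have := walk_lower Q (z := 0) (k := k) (rest := map (cellvec J) rest).
rewrite add0r => /(_ ek); rewrite raddf0 -/c0; apply: le_trans.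
have -> : sqnorm R (0 : {ffun option 'I_d -> int}) = 0.
  by rewrite /sqnorm big1 // => i _; rewrite ffunE expr0n.
rewrite add0r card_option card_ord big_map.
have c00 : 0 <= c0 by apply: le_trans (corr_walk_gt0 _ _); rewrite invr_ge0.
have M0 : 0 <= ln M%:R :> R by rewrite ln_ge0 // ler1n ltnW.
rewrite mulrBr mulr1 lerB //.
apply: le_trans (_ : (d.+1%:R * (4 * (d.+1%:R * ln M%:R / h%:R) * c0) / 8) *
    ((size rest)%:R * (d.+1 ^ 2)%:R) <= _).
  rewrite ler_wpM2l //; last by apply: ler_sum_size => w; exact: sqnorm_cellvec.
  by rewrite divr_ge0 // mulr_ge0 // mulr_ge0 // mulr_ge0 // divr_ge0 // mulr_ge0.
have sr : size rest = (n - 2 ^ d * (2 * h))%N.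
  have := perm_size prest; rewrite size_map size_enum_ord !size_cat !size_half_core.
  rewrite card_subsets card_ord; by move: (2 ^ d)%N => D; rewrite addnn -mul2n mulnCA => {1}->; rewrite addnK.
rewrite sr /star_err le_eqVlt; apply/orP; left; apply/eqP.
rewrite !natrX; field.
by rewrite pnatr_eq0 -lt0n.
Qed.

End StarBounds.

(** * Exact averages over tuples, and the Chernoff bound *)

Section Averages.
Variables (R : realType) (n d : nat).

Lemma card_Vtx : #|Vtx n| = NN n.
Proof. by rewrite /Vtx /NN card_draws card_ord. Qed.

Lemma card_neighbours m (y : {set 'I_n}) : n = (4 * m)%N -> y \in Vtx n ->
  #|[set A in Vtx n | #|A :&: y| == (n %/ 4)%N]| = NN1 n.
Proof.
move=> nm; rewrite inE => /eqP cy.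
have n4 : (n %/ 4 = m)%N by lia.
have n2 : (n %/ 2 = 2 * m)%N by lia.
pose draws (Z : {set 'I_n}) := [set B : {set 'I_n} | (B \subset Z) && (#|B| == (n %/ 4)%N)].
have cU (B C : {set 'I_n}) : B \in draws y -> C \in draws (~: y) ->
    (B :|: C) :&: y = B /\ (B :|: C) :\: y = C.
  rewrite !inE => /andP[By _] /andP[Cy _].
  have dC : C :&: y = set0.
    by apply/eqP; rewrite setI_eq0 -[y]setCK -subsets_disjoint.
  have dB : B :\: y = set0 by apply/eqP; rewrite setD_eq0.
  rewrite setIUl dC setU0 setDUl dB set0U; split; first exact/setIidPl.
  by apply/setDidPl; rewrite -setI_eq0 dC.
have -> : [set A in Vtx n | #|A :&: y| == (n %/ 4)%N] =
    [set BC.1 :|: BC.2 | BC in finset.setX (draws y) (draws (~: y))].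
  apply/setP => A; rewrite !inE; apply/andP/imsetP => [[/eqP cA /eqP cAy]|].
    exists (A :&: y, A :\: y); last by rewrite /= setID.
    rewrite !inE subsetIr cAy eqxx /= setDE subsetIr /= -setDE.
    have := cardsID y A; rewrite cA cAy n4 n2; move: #|_ :\: _| => X; lia.
  case=> -[B C]; rewrite inE /= => /andP[Bd Cd] ->.
  have [eB eC] := cU _ _ Bd Cd.
  rewrite -(cardsID y) eB eC; move: Bd Cd; rewrite !inE => /andP[_ /eqP ->] /andP[_ /eqP ->].
  by rewrite n4 n2 mul2n addnn.
rewrite card_in_imset => [|[B C] [B' C']]; last first.
  rewrite !inE /= => /andP[/andP[h1 h2] /andP[h3 h4]] /andP[/andP[h1' h2'] /andP[h3' h4']] e.
  have [e1 e2] := cU B C ltac:(by rewrite inE h1) ltac:(by rewrite inE h3).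
  have [e1' e2'] := cU B' C' ltac:(by rewrite inE h1') ltac:(by rewrite inE h3').
  have eB : B = B' := etrans (esym e1) (etrans (congr1 (fun A => A :&: y) e) e1').
  have eC : C = C' := etrans (esym e2) (etrans (congr1 (fun A => A :\: y) e) e2').
  by rewrite eB eC.
rewrite cardsX !cards_draws /NN1 cy; congr (_ * _)%N.
have -> // : #|~: y| = (n %/ 2)%N.
by have := cardsC y; rewrite cy card_ord n2; move: #|_| => X; lia.
Qed.

Definition tuples : {set {ffun 'I_d -> {set 'I_n}}} :=
  [set x : {ffun 'I_d -> {set 'I_n}} | [forall j, x j \in Vtx n]].

Lemma card_tuples : #|tuples| = (NN n ^ d)%N.
Proof.
rewrite -card_Vtx -[X in (_ ^ X)%N]card_ord -card_ffun_on; apply: eq_card => x.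
by rewrite inE; apply/forallP/ffun_onP.
Qed.

Lemma sum_star m (J : {set 'I_d}) : n = (4 * m)%N ->
  (\sum_(x : {ffun 'I_d -> {set 'I_n}} | x \in tuples) #|star x J| = NN n * (NN1 n ^ #|J| * NN n ^ (d - #|J|)))%N.
Proof.
move=> nm.
transitivity (\sum_(x : {ffun 'I_d -> {set 'I_n}} | x \in tuples) \sum_(y in Vtx n)
   \prod_j (if j \in J then (#|x j :&: y| == n %/ 4)%N : nat else 1))%N.
  apply: eq_bigr => x _; rewrite -sum1_card big_mkcond [RHS]big_mkcond /=; apply: eq_bigr => y _.
  rewrite inE; case: (y \in Vtx n) => //=; rewrite ?andbT ?andbF.
  case: (boolP [forall j in J, _]) => [/forall_inP h|/forall_inPn[j jJ /negbTE h]].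
    by rewrite big1 // => j _; case: ifP => // /h ->.
  by rewrite (bigD1 j) //= jJ h mul0n.
rewrite exchange_big /= -card_Vtx -sum_nat_const; apply: eq_bigr => y yV.
transitivity (\prod_(j : 'I_d) \sum_(A in Vtx n)
   (if j \in J then (#|A :&: y| == n %/ 4)%N : nat else 1))%N.
  rewrite bigA_distr_big_dep /= [RHS](eq_bigl (mem tuples)) //.
  by move=> x /=; apply/familyP/idP => [h|]; [rewrite inE; apply/forallP|rewrite inE => /forallP].
rewrite (bigID (mem J)) /=; congr (_ * _)%N.
  rewrite (eq_bigr (fun=> NN1 n)); first by rewrite prod_nat_const.
  move=> j jJ; rewrite -(card_neighbours nm yV) -sum1_card [RHS]big_mkcond [LHS]big_mkcond /=.
  by apply: eq_bigr => A _; rewrite !inE (jJ : j \in J); case: (#|A| == _); case: (#|_ :&: _| == _).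
rewrite (eq_bigr (fun=> #|Vtx n|)); last first.
  by move=> j /negbTE ->; rewrite sum1_card.
rewrite prod_nat_const; congr (_ ^ _)%N.
by rewrite -[X in (X - _)%N]card_ord -(cardC (mem J)) addKn.
Qed.

(** Ranges over tuples of arbitrary sets, for which the cells of the [n] coordinates are independent
    and uniform. Restricting to tuples of vertices costs at most a factor [(n + 1) ^ d] in
    proportion. *)
Definition unspread h : {set {ffun 'I_d -> {set 'I_n}}} :=
  [set x : {ffun 'I_d -> {set 'I_n}} | ~~ [forall w, (2 * h <= #|[set t | cell x t == w]|)%N]].

(** A union bound over the [2 ^ d] cells and an exponential moment for each. The moment factorises
    because tuples correspond bijectively to the functions sending a coordinate to its cell. *)
Lemma card_unspread h (s : R) : 0 <= s ->
  #|unspread h|%:R <= 2 ^+ d * (expR (s * (2 * h)%:R) * (2 ^+ d - 1 + expR (- s)) ^+ n).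
Proof.
move=> s0.
pose Y (x : {ffun 'I_d -> {set 'I_n}}) w := #|[set t | cell x t == w]|.
have mom (w : {set 'I_d}) : \sum_(x : {ffun 'I_d -> {set 'I_n}}) expR (- s * (Y x w)%:R) =
    (2 ^+ d - 1 + expR (- s)) ^+ n.
  pose F (u : {set 'I_d}) := if u == w then expR (- s) else 1.
  have sF : \sum_u F u = 2 ^+ d - 1 + expR (- s).
    rewrite (bigD1 w) //= /F eqxx addrC; congr (_ + _).
    rewrite (eq_bigr (fun=> 1)); last by move=> u /negbTE ->.
    rewrite sumr_const -natrX -(natrB _ (n := 1)) ?expn_gt0 //; congr _%:R.
    have := cardC1 w; rewrite card_subsets card_ord => cw.
    by rewrite subn1 -cw; apply: eq_card => u; rewrite !inE.
  rewrite -sF -[X in _ ^+ X]card_ord -prodr_const bigA_distr_bigA /=.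
  rewrite (reindex (fun x : {ffun 'I_d -> {set 'I_n}} => [ffun t => cell x t])) /=; last first.
    exists (fun c : {ffun 'I_n -> {set 'I_d}} => [ffun j => [set t | j \in c t]]) => z _.
      by apply/ffunP => j; rewrite ffunE; apply/setP => t; rewrite inE ffunE inE.
    by apply/ffunP => t; rewrite ffunE; apply/setP => j; rewrite inE ffunE inE.
  apply: eq_bigr => x _; rewrite /Y -sum1_card natr_sum mulr_sumr expR_sum.
  rewrite big_mkcond /=; apply: eq_bigr => t _.
  by rewrite ffunE inE /F mulr1.
have bd x : (x \in unspread h)%:R <= \sum_w expR (s * (2 * h)%:R) * expR (- s * (Y x w)%:R).
  have pos w : 0 <= expR (s * (2 * h)%:R) * expR (- s * (Y x w)%:R).
    by rewrite mulr_ge0 // expR_ge0.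
  rewrite inE; case: (boolP [forall w, _]) => [_|/forallPn[w]]; first by rewrite sumr_ge0.
  rewrite -ltnNge => hw; rewrite (bigD1 w) //= -expRD.
  apply: le_trans (_ : expR (s * (2 * h)%:R + - s * (Y x w)%:R) <= _); last by rewrite lerDl sumr_ge0.
  apply: le_trans (_ : expR 0 <= _); first by rewrite expR0.
  rewrite ler_expR mulNr -mulrBr mulr_ge0 // subr_ge0 ler_nat; exact: ltnW.
rewrite -sum1_card natr_sum big_mkcond /=.
apply: le_trans (_ : \sum_(x : {ffun 'I_d -> {set 'I_n}})
   \sum_w expR (s * (2 * h)%:R) * expR (- s * (Y x w)%:R) <= _).
  by apply: ler_sum => x _; apply: le_trans (bd x); case: ifP.
rewrite exchange_big /=.
under eq_bigr do rewrite -mulr_sumr mom.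
by rewrite sumr_const -[leLHS]mulr_natl card_subsets card_ord natrX.
Qed.

End Averages.

(** * Asymptotic scales *)

Lemma central_binomial_ge k : (4 ^ k <= k.*2.+1 * 'C(k.*2, k))%N.
Proof.
elim: k => [//|k IH].
have e1 : (k.+1 * 'C(k.*2.+2, k.+1) = 2 * (k.*2.+1 * 'C(k.*2, k)))%N.
  have h1 := mul_bin_diag k.*2.+2 k; have h2 := mul_bin_diag k.*2.+1 k.
  have h3 : ('C(k.*2.+1, k.+1) = 'C(k.*2.+1, k))%N.
    by rewrite -bin_sub; [congr ('C(_, _)); lia|lia].
  rewrite /= h3 in h1 h2; rewrite -h1 h2; move: 'C(k.*2.+1, k) => c; nia.
have e2 : (k.+1 * 4 ^ k.+1 <= k.+1 * (k.+1.*2.+1 * 'C(k.+1.*2, k.+1)))%N.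
  rewrite doubleS mulnCA e1 expnS.
  move: IH; move: (4 ^ k)%N (k.*2.+1 * _)%N => a b IH.
  apply: leq_trans (_ : k.+1 * (4 * b) <= _)%N; first by rewrite leq_mul2l leq_mul2l IH orbT.
  by rewrite mulnA [leqRHS]mulnA leq_mul2r; apply/orP; right; lia.
by move: e2; rewrite leq_mul2l.
Qed.

Section Asymptotics.
Variable R : realType.
Local Open Scope classical_set_scope.

Definition NR (m : nat) : R := (NN (4 * m))%:R.
(** Edge density of the complete distance graph. By [theta_ge] its inverse is at most polynomial in
    [n], so negligible quantities remain so after division by powers of [theta]. *)
Definition theta (m : nat) : R := (NN1 (4 * m))%:R / NR m.

Lemma NR_ge m : 2 ^+ (4 * m) <= (4 * m).+1%:R * NR m.
Proof.
rewrite /NR -natrX -natrM ler_nat /NN (_ : 4 * m %/ 2 = 2 * m)%N; last by lia.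
rewrite (_ : 4 * m = (2 * m).*2)%N; last by lia.
have -> : (2 ^ (2 * m).*2 = 4 ^ (2 * m))%N by rewrite -muln2 mulnC expnM.
exact: central_binomial_ge.
Qed.

Lemma NR_gt0 m : 0 < NR m.
Proof. by rewrite ltr0n bin_gt0 leq_div. Qed.

Lemma NR_le m : NR m <= 2 ^+ (4 * m).
Proof. by rewrite /NR -card_Vtx -natrX ler_nat -[X in (_ ^ X)%N]card_ord -card_subsets max_card. Qed.

Lemma theta_ge m : (4 * m).+1%:R ^- 2 <= theta m.
Proof.
rewrite /theta ler_pdivlMr ?NR_gt0 // mulrC ler_pdivrMr ?exprn_gt0 //.
apply: le_trans (NR_le m) _.
have h := central_binomial_ge m.
rewrite -!natrX -natrM ler_nat /NN1.
rewrite (_ : 4 * m %/ 2 = m.*2)%N; last by lia.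
rewrite (_ : 4 * m %/ 4 = m)%N; last by lia.
have -> : (2 ^ (4 * m) = (4 ^ m) ^ 2)%N by rewrite -!expnM (_ : 4 = 2 ^ 2)%N // -expnM; congr (_ ^ _)%N; lia.
rewrite -expnMn leq_exp2r // mulnC; apply: leq_trans h _.
by rewrite leq_mul2r; apply/orP; right; lia.
Qed.

Lemma theta_gt0 m : 0 < theta m.
Proof. by apply: lt_le_trans (theta_ge m); rewrite invr_gt0 exprn_gt0. Qed.

Lemma theta_le1 m : theta m <= 1.
Proof.
rewrite ler_pdivrMr ?NR_gt0 // mul1r ler_nat -card_Vtx.
have : (0 < #|Vtx (4 * m)|)%N by have := NR_gt0 m; rewrite /NR ltr0n -card_Vtx.
case/card_gt0P => y yV; rewrite -(@card_neighbours _ m y erefl yV).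
by apply: subset_leq_card; apply/subsetP => A; rewrite inE => /andP[].
Qed.

(* All intermediate scales are powers of the eighth root of [n = 4m]: a tuple is
   spread when its [2 ^ d] cells have size at least about [n / 2 ^ d - n / root8 ^ 2]. *)
Definition root8 (m : nat) : R := Num.sqrt (Num.sqrt (Num.sqrt (4 * m)%:R)).

Lemma root8X m : root8 m ^+ 8 = (4 * m)%:R.
Proof. by rewrite /root8 (exprM _ 4 2) (exprM _ 2 2) !sqr_sqrtr ?sqrtr_ge0. Qed.

Lemma root8_ge0 m : 0 <= root8 m.
Proof. exact: sqrtr_ge0. Qed.

Lemma root8_large (A : R) : \forall m \near \oo, A <= root8 m.
Proof.
near=> m.
have [A0|A0] := leP A 0; first exact: le_trans (root8_ge0 m).
rewrite -(@ler_pXn2r _ 8) ?nnegrE ?root8_ge0 ?(ltW A0) // root8X.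
apply: le_trans (_ : m%:R <= _); last by rewrite ler_nat leq_pmull.
by near: m; apply: nbhs_infty_ger.
Unshelve. all: by end_near. Qed.

Lemma root8V_cvg0 (C : R) : (fun m => C / root8 m) @ \oo --> (0 : R).
Proof.
rewrite -(mulr0 C); apply: cvgMr; apply/cvgr0Pnorm_le => e e0.
near=> m.
have : e^-1 <= root8 m by near: m; apply: root8_large.
move=> h; have p : 0 < root8 m by apply: lt_le_trans h; rewrite invr_gt0.
by rewrite ger0_norm ?invr_ge0 ?(ltW p) // -[e]invrK lef_pV2 ?posrE ?invr_gt0.
Unshelve. all: by end_near. Qed.

Lemma ln_root8 m : ln (4 * m)%:R <= 8 * root8 m.
Proof.
have [->|m0] := posnP m; first by rewrite muln0 ln0 ?mulr_ge0 ?root8_ge0.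
have v0 : 0 < root8 m by rewrite !sqrtr_gt0 ltr0n muln_gt0.
rewrite -root8X lnXn // -[leLHS]mulr_natl ler_wpM2l //.
apply: le_trans (ltW (le_lt_trans (_ : _ <= root8 m - 1) _)) => //; last by rewrite gtrBl.
by have := @le_ln1Dx R (root8 m - 1); rewrite [1 + _]addrC subrK; apply; lra.
Qed.

Definition negligible (f : nat -> R) :=
  forall K, (fun m => (4 * m).+1%:R ^+ K * f m) @ \oo --> (0 : R).

Lemma negligible_cvg0 f : negligible f -> f @ \oo --> (0 : R).
Proof. by move=> /(_ 0%N); under eq_fun do rewrite expr0 mul1r. Qed.

Lemma negligible_le f g (C : R) K :
  (\forall m \near \oo, 0 <= g m <= C * (4 * m).+1%:R ^+ K * f m) -> negligible f -> negligible g.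
Proof.
move=> gf nf L.
apply: (@squeeze_cvgr _ _ _ _ (fun=> 0) (fun m => C * ((4 * m).+1%:R ^+ (L + K) * f m))).
- near=> m.
  have /andP[g0 gle] : 0 <= g m <= C * (4 * m).+1%:R ^+ K * f m by near: m.
  rewrite mulr_ge0 ?exprn_ge0 //= exprD -!mulrA mulrCA ler_wpM2l ?exprn_ge0 //.
  by rewrite mulrA.
- exact: cvg_cst.
- by rewrite -(mulr0 C); apply: cvgMr; apply: nf.
Unshelve. all: by end_near. Qed.

Lemma negligible_expR : negligible (fun m => expR (- (root8 m ^+ 4 / 4))).
Proof.
move=> K.
(* The power [P] of [root8 m ^+ 4 / 4] is of order [root8 ^ (8K + 4)], which beats the
   [root8 ^ (8K)] coming from [n ^ K]. *)
pose P := (2 * K + 1)%N.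
pose C : R := 2 ^+ K * (P`!%:R * 4 ^+ P).
apply: (@squeeze_cvgr _ _ _ _ (fun=> 0) (fun m => C / root8 m)).
- near=> m.
  have v1 : 1 <= root8 m by near: m; apply: root8_large.
  have v0 : 0 < root8 m by lra.
  rewrite mulr_ge0 ?exprn_ge0 ?expR_ge0 //=.
  have n2 : (4 * m).+1%:R <= 2 * root8 m ^+ 8.
    by rewrite -natr1 -root8X mulr2n mulrDl mul1r lerD2l exprn_ege1.
  have h1 : (4 * m).+1%:R ^+ K <= 2 ^+ K * root8 m ^+ (8 * K).
    by rewrite exprM -exprMn lerXn2r // nnegrE ?mulr_ge0 ?exprn_ge0 ?(ltW v0).
  set y := root8 m ^+ 4 / 4.
  have y0 : 0 < y by rewrite divr_gt0 ?exprn_gt0.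
  have h2 : expR (- y) <= P`!%:R / y ^+ P.
    rewrite expRN -[leRHS]invrK lef_pV2 ?posrE ?expR_gt0 ?invr_gt0 ?divr_gt0 ?exprn_gt0 ?ltr0n ?fact_gt0 //.
    rewrite invf_div /P addn1; have := @expR_ge1Dxn R y (2 * K) (ltW y0).
    by apply: le_trans; rewrite lerDr.
  apply: le_trans (_ : (2 ^+ K * root8 m ^+ (8 * K)) * (P`!%:R / y ^+ P) <= _).
    by rewrite ler_pM ?exprn_ge0 ?expR_ge0.
  have -> : (2 ^+ K * root8 m ^+ (8 * K)) * (P`!%:R / y ^+ P) = C / root8 m ^+ 4.
    have -> : y ^+ P = root8 m ^+ (8 * K) * root8 m ^+ 4 / 4 ^+ P.
      by rewrite /y exprMn exprVn -exprM -exprD; congr (_ ^+ _ / _); rewrite /P; lia.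
    by rewrite /C; field; rewrite !expf_neq0 ?gt_eqF.
  rewrite ler_wpM2l ?mulr_ge0 ?exprn_ge0 // lef_pV2 ?posrE ?exprn_gt0 //.
  by rewrite exprS ler_peMr ?exprn_ege1 // (ltW v0).
- exact: cvg_cst.
- exact: root8V_cvg0.
Unshelve. all: by end_near. Qed.

Lemma negligible_NRV : negligible (fun m => (NR m)^-1).
Proof.
apply: (@negligible_le _ _ 1 1 _ negligible_expR).
near=> m.
rewrite invr_ge0 (ltW (NR_gt0 m)) /= mul1r expr1.
have v1 : 1 <= root8 m by near: m; apply: root8_large.
apply: le_trans (_ : (4 * m).+1%:R / 2 ^+ (4 * m) <= _).
  rewrite ler_pdivlMr ?exprn_gt0 // mulrC ler_pdivrMr ?NR_gt0 //; exact: NR_ge.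
rewrite ler_wpM2l // expRN lef_pV2 ?posrE ?expR_gt0 ?exprn_gt0 //.
apply: le_trans (_ : expR (root8 m ^+ 8 / 4) <= _).
  by rewrite ler_expR ler_wpM2r // ler_weXn2l.
rewrite root8X natrM mulrC mulKf // exprM -[m%:R]mulr1 expRM_natl.
rewrite lerXn2r ?nnegrE ?expR_ge0 ?exprn_ge0 //.
have h : expR (2^-1) <= 2 :> R.
  rewrite -[expR _]invrK -expRN invf_ple ?posrE ?expR_gt0 //.
  by have := @expR_ge1Dx R (- 2^-1); lra.
rewrite (_ : 1 = 2^-1 + 2^-1 :> R); last by lra.
rewrite expRD; apply: le_trans (_ : 2 * 2 <= _); last by lra.
by rewrite ler_pM ?expR_ge0.
Unshelve. all: by end_near. Qed.

Section Scales.
Variable d : nat.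

Definition half_size (m : nat) : nat :=
  Num.truncn ((4 * m)%:R * ((2 ^+ d)^-1 - root8 m ^- 2) / 2 : R).
(** Exceeds the bound of [signed_sum_bound], which rules out wrap-around, and stays above 1 at
    [m = 0]. *)
Definition modulus (m : nat) : nat := (4 * m * d.+1).+2.
Definition rho8 m : R := (2 ^+ d)^-1 * root8 m ^+ 8 - root8 m ^+ 6.

Lemma half_size_bounds : \forall m \near \oo,
  rho8 m - 2 <= 2 * (half_size m)%:R <= rho8 m.
Proof.
near=> m.
have v1 : 1 <= root8 m by near: m; apply: root8_large.
have v2 : 2 ^+ d <= root8 m by near: m; apply: root8_large.
have v0 : 0 < root8 m by lra.
have D0 : (0 : R) < 2 ^+ d by rewrite exprn_gt0.
have e : (4 * m)%:R * ((2 ^+ d)^-1 - root8 m ^- 2) = rho8 m.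
  by rewrite -root8X /rho8; field; rewrite !expf_neq0 ?gt_eqF.
have r0 : 0 <= rho8 m.
  rewrite -e mulr_ge0 // subr_ge0 lef_pV2 ?posrE ?exprn_gt0 //.
  by apply: le_trans v2 _; rewrite expr2 ler_peMr // ltW.
rewrite /half_size e.
have /andP[h1 h2] := truncn_itv (divr_ge0 r0 (ler0n R 2)).
rewrite -[X in _ < X]natr1 in h2.
by apply/andP; split; lra.
Unshelve. all: by end_near. Qed.

Lemma half_size_large : \forall m \near \oo,
  (4 * 2 ^+ d)^-1 * root8 m ^+ 8 <= (half_size m)%:R.
Proof.
near=> m.
have v1 : 8 * 2 ^+ d <= root8 m by near: m; apply: root8_large.
have D1 : (1 : R) <= 2 ^+ d by rewrite exprn_ege1 ?ler1n.
have /andP[h _] : rho8 m - 2 <= 2 * (half_size m)%:R <= rho8 m by near: m; apply: half_size_bounds.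
have v4 : 1 <= root8 m by lra.
have h6 : 8 * 2 ^+ d * root8 m ^+ 6 <= root8 m ^+ 8.
  rewrite -[8%N]/(2 + 6)%N exprD ler_wpM2r ?exprn_ge0 ?root8_ge0 //.
  by apply: le_trans v1 _; rewrite expr2 ler_peMr ?root8_ge0.
have h61 : 1 <= root8 m ^+ 6 by rewrite exprn_ege1.
have -> : (4 * 2 ^+ d)^-1 = (2 ^+ d)^-1 / 4 :> R by rewrite invfM mulrC.
move: h; rewrite /rho8.
have : root8 m ^+ 6 * 8 <= (2 ^+ d)^-1 * root8 m ^+ 8.
  rewrite [leRHS]mulrC ler_pdivlMr ?exprn_gt0 //; apply: le_trans h6.
  by rewrite le_eqVlt; apply/orP; left; apply/eqP; ring.
lra.
Unshelve. all: by end_near. Qed.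

(** With [v = root8 m]: at most [3 * 2 ^ d * v ^ 6] steps lie outside the doubled core, [ln M] is
    [O(v)], and [h] is at least [v ^ 8 / (4 * 2 ^ d)]. This leaves [K / v]. *)
Lemma star_err_cvg0 : (fun m => star_err R (4 * m) d (modulus m) (half_size m)) @ \oo --> (0 : R).
Proof.
pose K : R := (d.+1 ^ 4)%:R / 2 * (2 ^+ d * 3) * ((ln (d + 3)%:R + 8) * (4 * 2 ^+ d)).
apply: (@squeeze_cvgr _ _ _ _ (fun=> 0) (fun m => K / root8 m)).
- near=> m.
  have v1 : 1 <= root8 m by near: m; apply: root8_large.
  have v0 : 0 < root8 m by lra.
  have D0 : (0 : R) < 2 ^+ d by rewrite exprn_gt0.
  have m0 : (0 < m)%N.
    rewrite lt0n; apply/eqP => m0; move: v0.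
    by rewrite /root8 m0 muln0 !sqrtr0 ltxx.
  have hl : (4 * 2 ^+ d)^-1 * root8 m ^+ 8 <= (half_size m)%:R by near: m; apply: half_size_large.
  have /andP[hb _] : rho8 m - 2 <= 2 * (half_size m)%:R <= rho8 m by near: m; apply: half_size_bounds.
  have h0 : 0 < (half_size m)%:R :> R.
    by apply: lt_le_trans hl; rewrite mulr_gt0 ?invr_gt0 ?mulr_gt0 ?exprn_gt0.
  have lnM0 : 0 <= ln (modulus m)%:R :> R by rewrite ln_ge0 // ler1n.
  have lnM : ln (modulus m)%:R <= (ln (d + 3)%:R + 8) * root8 m.
    apply: le_trans (_ : ln ((d + 3)%:R * (4 * m)%:R) <= _).
      rewrite ler_ln ?posrE ?ltr0n // -?natrM ?ltr0n ?ler_nat ?muln_gt0 ?addn_gt0 ?orbT //.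
      by rewrite /modulus; nia.
    rewrite lnM ?posrE ?ltr0n ?muln_gt0 ?addn_gt0 ?orbT // mulrDl lerD ?ln_root8 //.
    by rewrite ler_peMr // ln_ge0 // ler1n addn_gt0 orbT.
  have r3 : (4 * m - 2 ^ d * (2 * half_size m))%:R <= 2 ^+ d * 3 * root8 m ^+ 6.
    case: (leqP (2 ^ d * (2 * half_size m)) (4 * m)) => hm; last first.
      rewrite (_ : (_ - _ = 0)%N); last by apply/eqP; rewrite subn_eq0 ltnW.
      by rewrite !mulr_ge0 // ?exprn_ge0 // ltW.
    rewrite natrB // !natrM natrX -natrM -root8X.
    have : 2 ^+ d * (rho8 m - 2) <= 2 ^+ d * (2 * (half_size m)%:R) by rewrite ler_wpM2l // ltW.
    have -> : 2 ^+ d * (rho8 m - 2) = root8 m ^+ 8 - 2 ^+ d * root8 m ^+ 6 - 2 ^+ d * 2.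
      by rewrite /rho8; field; rewrite gt_eqF.
    have : 2 ^+ d <= 2 ^+ d * root8 m ^+ 6 by rewrite ler_peMr ?exprn_ege1 // ltW.
    lra.
  rewrite /star_err; apply/andP; split.
    by rewrite !mulr_ge0 ?divr_ge0 // invr_ge0 ltW.
  apply: le_trans (_ : (d.+1 ^ 4)%:R / 2 * (2 ^+ d * 3 * root8 m ^+ 6) *
     ((ln (d + 3)%:R + 8) * root8 m / ((4 * 2 ^+ d)^-1 * root8 m ^+ 8)) <= _).
    apply: ler_pM.
    + by rewrite mulr_ge0 // divr_ge0.
    + by rewrite divr_ge0 // ltW.
    + by rewrite ler_wpM2l // divr_ge0.
    + apply: ler_pM => //.
      rewrite lef_pV2 ?posrE //.
      by rewrite mulr_gt0 ?invr_gt0 ?mulr_gt0 ?exprn_gt0.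
  rewrite le_eqVlt; apply/orP; left; apply/eqP.
  by rewrite /K; field; rewrite ?expf_neq0 ?gt_eqF.
- exact: cvg_cst.
- exact: root8V_cvg0.
Unshelve. all: by end_near. Qed.

Definition bad_ratio m : R := #|unspread (4 * m) d (half_size m)|%:R / NR m ^+ d.

Lemma bad_ratio_ge0 m : 0 <= bad_ratio m.
Proof. by rewrite divr_ge0 ?exprn_ge0 // ltW ?NR_gt0. Qed.

Lemma negligible_bad_ratio : negligible bad_ratio.
Proof.
apply: (@negligible_le _ _ (2 ^+ d) d _ negligible_expR).
near=> m.
have v1 : 1 <= root8 m by near: m; apply: root8_large.
have v0 : 0 < root8 m by lra.
have D0 : (0 : R) < 2 ^+ d by rewrite exprn_gt0.
have D1 : (1 : R) <= 2 ^+ d by rewrite exprn_ege1 ?ler1n.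
have /andP[_ hb] : rho8 m - 2 <= 2 * (half_size m)%:R <= rho8 m by near: m; apply: half_size_bounds.
rewrite bad_ratio_ge0 /= ler_pdivrMr ?exprn_gt0 ?NR_gt0 //.
(* In the exponent the linear terms of order [root8 ^ 8] cancel. With this [s] the deviation
   contributes [- root8 ^ 4 / 2], against a quadratic term of at most [root8 ^ 4 / 4]. *)
pose s : R := root8 m ^- 2 / 2.
have s0 : 0 < s by rewrite divr_gt0 ?invr_gt0 ?exprn_gt0.
have s1 : s <= 1.
  rewrite /s ler_pdivrMr // mul1r.
  apply: le_trans (_ : 1 <= _); last by lra.
  by rewrite invf_le1 ?exprn_gt0 ?exprn_ege1.
apply: le_trans (card_unspread _ _ _ (ltW s0)) _.
have es : expR (- s) <= 1 - s + s ^+ 2.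
  rewrite expRN -[leRHS]invrK lef_pV2 ?posrE ?expR_gt0 //; last first.
    by rewrite invr_gt0; nra.
  apply: le_trans (expR_ge1Dx s); rewrite invf_ple ?posrE; [|nra|lra].
  rewrite -[leLHS]mul1r ler_pdivrMr; last by lra.
  have : 0 <= s ^+ 3 by rewrite exprn_ge0 // ltW.
  lra.
have step : 2 ^+ d - 1 + expR (- s) <= 2 ^+ d * expR (- ((2 ^+ d)^-1 * (s - s ^+ 2))).
  apply: le_trans (_ : 2 ^+ d * (1 - (2 ^+ d)^-1 * (s - s ^+ 2)) <= _).
    by rewrite mulrBr mulrA mulfV ?gt_eqF // mul1r mulr1; lra.
  by rewrite ler_wpM2l ?(ltW D0) //; apply: le_trans (expR_ge1Dx _).
apply: le_trans (_ : 2 ^+ d * (expR (s * rho8 m) *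
   (2 ^+ d * expR (- ((2 ^+ d)^-1 * (s - s ^+ 2)))) ^+ (4 * m)) <= _).
  rewrite ler_wpM2l ?(ltW D0) //; apply: ler_pM.
  - exact: expR_ge0.
  - rewrite exprn_ge0 // addr_ge0 ?expR_ge0 //; lra.
  - by rewrite ler_expR ler_wpM2l ?(ltW s0) // natrM.
  - rewrite lerXn2r ?nnegrE ?mulr_ge0 ?expR_ge0 ?(ltW D0) //.
    by rewrite addr_ge0 ?expR_ge0 //; lra.
rewrite exprMn -expRM_natl.
have eexp : expR (s * rho8 m) * (2 ^+ d ^+ (4 * m) * expR ((4 * m)%:R * - ((2 ^+ d)^-1 * (s - s ^+ 2)))) =
   (2 ^+ (4 * m)) ^+ d * expR (s * rho8 m + (4 * m)%:R * - ((2 ^+ d)^-1 * (s - s ^+ 2))).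
  by rewrite expRD -!exprM [(d * _)%N]mulnC; ring.
rewrite [leRHS](_ : _ = 2 ^+ d * (((4 * m).+1%:R * NR m) ^+ d * expR (- (root8 m ^+ 4 / 4)))); last first.
  by rewrite exprMn; ring.
rewrite eexp ler_wpM2l ?(ltW D0) //; apply: ler_pM; rewrite ?expR_ge0 ?exprn_ge0 //.
  by rewrite lerXn2r ?nnegrE ?mulr_ge0 ?exprn_ge0 ?(ltW (NR_gt0 m)) //; apply: NR_ge.
rewrite ler_expR -root8X.
have -> : s * rho8 m + root8 m ^+ 8 * - ((2 ^+ d)^-1 * (s - s ^+ 2)) =
     - (root8 m ^+ 4 / 2) + (2 ^+ d)^-1 * (root8 m ^+ 4 / 4).
  by rewrite /s /rho8; field; rewrite ?expf_neq0 ?gt_eqF.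
have : (2 ^+ d)^-1 * (root8 m ^+ 4 / 4) <= root8 m ^+ 4 / 4.
  by rewrite ler_piMl ?divr_ge0 ?exprn_ge0 ?root8_ge0 // invf_le1.
lra.
Unshelve. all: by end_near. Qed.

End Scales.
End Asymptotics.

(** * Counting homomorphisms into the complete distance graph *)

Section Homs.
Variable d : nat.
Definition homs (F : rel 'I_d) n : {set {ffun 'I_d -> {set 'I_n}}} :=
  [set x : {ffun 'I_d -> {set 'I_n}} | [forall j, x j \in Vtx n] &&
    [forall i, forall j, F i j ==> (#|x i :&: x j| == (n %/ 4)%N)]].

(** Edges as increasing pairs, so that deleting the last vertex splits off one summand. *)
Definition ecount (F : rel 'I_d) : nat := (\sum_(j < d) \sum_(i < d) ((i < j) && F i j))%N.
End Homs.

Section Extension.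
Variables (d : nat) (F : rel 'I_d.+1).
Hypotheses (Fsym : symmetric F) (Firr : irreflexive F).

Definition del_max : rel 'I_d := fun i j => F (lift ord_max i) (lift ord_max j).
Definition nbrs_max : {set 'I_d} := [set j | F (lift ord_max j) ord_max].

Lemma ecount_del_max : ecount F = (ecount del_max + #|nbrs_max|)%N.
Proof.
have wl (i : 'I_d) : widen_ord (leqnSn d) i = lift ord_max i.
  by apply: val_inj; exact: esym (lift_max i).
rewrite /ecount big_ord_recr /=; congr (_ + _)%N.
  apply: eq_bigr => j _; rewrite big_ord_recr /= ltnNge ltnW ?ltn_ord // addn0.
  by apply: eq_bigr => i _; rewrite /del_max !wl.
rewrite big_ord_recr /= ltnn addn0 -sum1_card [RHS]big_mkcond /=.
by apply: eq_bigr => i _; rewrite ltn_ord wl inE; case: (F _ _).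
Qed.

Lemma card_homs_extend n : #|homs F n| = (\sum_(x in homs del_max n) #|star x nbrs_max|)%N.
Proof.
pose restr (z : {ffun 'I_d.+1 -> {set 'I_n}}) : {ffun 'I_d -> {set 'I_n}} :=
  [ffun j : 'I_d => z (lift ord_max j)].
rewrite -sum1_card (partition_big restr (mem (homs del_max n))) /=; last first.
  move=> z; rewrite !inE => /andP[/forallP zV /'forall_forallP zF]; apply/andP; split.
    by apply/forallP => j; rewrite ffunE.
  by apply/'forall_forallP => i j; rewrite !ffunE; apply: zF.
apply: eq_bigr => x; rewrite inE => /andP[/forallP xV /'forall_forallP xF].
rewrite sum1dep_card -(card_in_imset (f := fun z : {ffun 'I_d.+1 -> {set 'I_n}} => z ord_max)).
  apply: eq_card => y; apply/imsetP/idP => [[z]|].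
    rewrite !inE => /andP[/andP[/forallP zV /'forall_forallP zF] /eqP zx] ->.
    apply/andP; split; first by have := zV ord_max; rewrite inE.
    apply/forall_inP => j; rewrite inE -zx ffunE => Fj.
    by have := zF (lift ord_max j) ord_max; rewrite Fj.
  rewrite !inE => /andP[yV /forall_inP yF].
  pose z : {ffun 'I_d.+1 -> {set 'I_n}} := [ffun i : 'I_d.+1 => if unlift ord_max i is Some j then x j else y].
  have zl j : z (lift ord_max j) = x j by rewrite ffunE liftK.
  have zm : z ord_max = y by rewrite ffunE unlift_none.
  exists z => //; rewrite !inE; apply/andP; split; last first.
    by apply/eqP/ffunP => j; rewrite ffunE zl.
  apply/andP; split.
    apply/forallP => i; case: (unliftP ord_max i) => [j|] ->; rewrite ?zl ?zm ?xV //.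
    by rewrite inE.
  apply/'forall_forallP => i j; apply/implyP.
  case: (unliftP ord_max i) => [i'|] ->; case: (unliftP ord_max j) => [j'|] ->; rewrite ?zl ?zm => Fij.
  - by have /implyP := xF i' j'; apply.
  - by apply: yF; rewrite inE.
  - by rewrite setIC; apply: yF; rewrite inE Fsym.
  - by rewrite Firr in Fij.
move=> z z'; rewrite !inE => /andP[_ /eqP zx] /andP[_ /eqP zx'] em.
apply/ffunP => i; case: (unliftP ord_max i) => [j|] -> //.
by have := congr1 (fun f : {ffun 'I_d -> {set 'I_n}} => f j) (etrans zx (esym zx')); rewrite !ffunE.
Qed.
End Extension.

Section HomAsymptotics.
Variable R : realType.
Local Open Scope classical_set_scope.

Section Fixed.
Variables (d : nat) (J : {set 'I_d}).

Definition star_scale m : R := star_max R (4 * m) (modulus d m) J (half_size R d m).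
Definition star_loss m : R := star_err R (4 * m) d (modulus d m) (half_size R d m).
Definition num_unspread m : R := #|unspread (4 * m) d (half_size R d m)|%:R.

Lemma star_scale_ge0 m : 0 <= star_scale m.
Proof.
rewrite mulr_ge0 ?exprn_ge0 //; apply: le_trans (corr_walk_gt0 _ _).
by rewrite invr_ge0.
Qed.

(** Stated for an arbitrary family [H]: all tuples serve to calibrate [star_scale], the
    homomorphisms of a smaller graph to extend them. Condition [star_loss m <= 1] keeps the lower
    factor nonnegative when [H] loses its unspread members. *)
Lemma star_sum_bounds m (H : {set {ffun 'I_d -> {set 'I_(4 * m)}}}) :
  H \subset tuples (4 * m) d -> (0 < half_size R d m)%N -> star_loss m <= 1 ->
  star_scale m * (1 - star_loss m) * (#|H|%:R - num_unspread m) <= \sum_(x in H) #|star x J|%:R <=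
  star_scale m * #|H|%:R + num_unspread m * NR R m.
Proof.
move=> /subsetP Ht h0 err1.
set U := unspread (4 * m) d (half_size R d m).
have bnd x : x \in H -> x \notin U -> star_scale m * (1 - star_loss m) <= #|star x J|%:R <= star_scale m.
  move=> /Ht; rewrite !inE negbK => /forallP xV /forallP xs.
  by apply: (@star_bounds R (4 * m) d (modulus d m) m) => //; rewrite /modulus ltnS leqnSn.
have cHU : #|H :\: U|%:R >= #|H|%:R - num_unspread m.
  rewrite -(cardsID U H) natrD /num_unspread -/U.
  have : #|H :&: U|%:R <= #|U|%:R :> R by rewrite ler_nat subset_leq_card // subsetIr.
  lra.
have split_sum : \sum_(x in H) #|star x J|%:R =
   \sum_(x in H :&: U) #|star x J|%:R + \sum_(x in H :\: U) #|star x J|%:R :> R.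
  rewrite (bigID (mem U)) /=; congr (_ + _); apply: eq_bigl => x; rewrite !inE //.
  by rewrite andbC.
rewrite split_sum; apply/andP; split.
- apply: le_trans (_ : star_scale m * (1 - star_loss m) * #|H :\: U|%:R <= _).
    by rewrite ler_wpM2l // mulr_ge0 ?star_scale_ge0 // subr_ge0.
  apply: le_trans (_ : \sum_(x in H :\: U) #|star x J|%:R <= _).
    rewrite mulr_natr -sumr_const; apply: ler_sum => x; rewrite inE => /andP[xU xH].
    by case/andP: (bnd x xH xU).
  by rewrite lerDr sumr_ge0.
- rewrite addrC; apply: lerD.
    apply: le_trans (_ : \sum_(x in H :\: U) star_scale m <= _).
      apply: ler_sum => x; rewrite inE => /andP[xU xH].
      by case/andP: (bnd x xH xU).
    rewrite sumr_const -[leLHS]mulr_natr ler_wpM2l ?star_scale_ge0 // ler_nat.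
    exact/subset_leq_card/subsetDl.
  apply: le_trans (_ : \sum_(x in H :&: U) NR R m <= _).
    apply: ler_sum => x _; rewrite /NR -card_Vtx ler_nat; apply: subset_leq_card.
    by apply/subsetP => y; rewrite inE => /andP[].
  rewrite sumr_const -[leLHS]mulr_natl ler_wpM2r ?(ltW (NR_gt0 _ _)) // ler_nat.
  exact/subset_leq_card/subsetIr.
Qed.

Lemma star_loss_cvg0 : star_loss @ \oo --> (0 : R).
Proof. exact: star_err_cvg0. Qed.

Lemma near_good : \forall m \near \oo, (0 < half_size R d m)%N /\ star_loss m <= 1 / 2.
Proof.
near=> m; split.
  have v1 : 1 <= root8 R m by near: m; apply: root8_large.
  have v8 : 0 < root8 R m ^+ 8 by rewrite exprn_gt0 //; lra.
  rewrite -(ltr_nat R); apply: lt_le_trans (_ : (4 * 2 ^+ d)^-1 * root8 R m ^+ 8 <= _).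
    by apply: mulr_gt0 => //; rewrite invr_gt0; apply: mulr_gt0; rewrite ?exprn_gt0.
  by near: m; apply: half_size_large.
apply: le_trans (ler_norm _) _.
by near: m; move/cvgr0Pnorm_le: star_loss_cvg0; apply.
Unshelve. all: by end_near. Qed.

Lemma negligible_theta (f : nat -> R) e : (forall m, 0 <= f m) -> negligible f ->
  (fun m => f m / theta R m ^+ e) @ \oo --> (0 : R).
Proof.
move=> f0 nf; apply/negligible_cvg0/(@negligible_le _ _ _ 1 (2 * e)%N _ nf).
near=> m; rewrite divr_ge0 ?exprn_ge0 ?(ltW (theta_gt0 _ _)) //= mul1r mulrC.
rewrite ler_wpM2r // exprM -[leRHS]invrK lef_pV2 ?posrE ?invr_gt0 ?exprn_gt0 ?theta_gt0 //.
by rewrite -exprVn lerXn2r ?nnegrE ?invr_ge0 ?exprn_ge0 ?(ltW (theta_gt0 _ _)) // theta_ge.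
Unshelve. all: by end_near. Qed.

Definition star_mean m : R := NR R m * theta R m ^+ #|J|.

Lemma star_mean_gt0 m : 0 < star_mean m.
Proof. by rewrite mulr_gt0 ?NR_gt0 ?exprn_gt0 ?theta_gt0. Qed.

(** For [H] the set of all tuples the sum is [NR m ^+ d * star_mean m] exactly. Solving the two
    estimates for [star_scale], the upper one bounds it from below and the lower one from above. *)
Lemma star_scale_cvg1 : (fun m => star_scale m / star_mean m) @ \oo --> (1 : R).
Proof.
have b0 := bad_ratio_ge0 R d; have nb := @negligible_bad_ratio R d.
have bad_cvg0 := negligible_cvg0 nb.
apply: (@squeeze_cvgr _ _ _ _ (fun m => 1 - bad_ratio R d m / theta R m ^+ #|J|)
   (fun m => ((1 - star_loss m) * (1 - bad_ratio R d m))^-1)).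
- near=> m.
  have [h0 er] : (0 < half_size R d m)%N /\ star_loss m <= 1 / 2 by near: m; apply: near_good.
  have br : bad_ratio R d m <= 1 / 2.
    apply: le_trans (ler_norm _) _.
    by near: m; move/cvgr0Pnorm_le: bad_cvg0; apply.
  have err1 : star_loss m <= 1 by lra.
  have := star_sum_bounds (subxx _) h0 err1.
  have Nd : 0 < NR R m ^+ d by rewrite exprn_gt0 ?NR_gt0.
  have Tm := star_mean_gt0 m; have tm : 0 < theta R m ^+ #|J| by rewrite exprn_gt0 ?theta_gt0.
  have Jd : (#|J| <= d)%N by rewrite -[leqRHS]card_ord max_card.
  have N0 := NR_gt0 R m.
  have -> : \sum_(x in tuples (4 * m) d) #|star x J|%:R = NR R m ^+ d * star_mean m :> R.
    rewrite -natr_sum (sum_star J (erefl : (4 * m)%N = (4 * m)%N)).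
    have cast (a b c j k : nat) : (a * (b ^ j * c ^ k))%N%:R = a%:R * (b%:R ^+ j * c%:R ^+ k) :> R.
      by rewrite !natrM !natrX.
    rewrite cast -/(NR R m).
    have -> : (NN1 (4 * m))%:R = theta R m * NR R m :> R by rewrite divfK ?gt_eqF.
    by rewrite /star_mean exprMn -mulrA -exprD subnKC //; ring.
  have -> : #|tuples (4 * m) d|%:R = NR R m ^+ d :> R by rewrite card_tuples natrX.
  have -> : num_unspread m = bad_ratio R d m * NR R m ^+ d by rewrite /bad_ratio divfK ?gt_eqF.
  move: (bad_ratio R d m) br (b0 m) => b br bm0 /andP[h1 h2].
  apply/andP; split.
    rewrite ler_pdivlMr // -(ler_pM2l Nd).
    apply: le_trans (_ : NR R m ^+ d * star_mean m - b * NR R m ^+ d * NR R m <= _).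
      rewrite le_eqVlt; apply/orP; left; apply/eqP; rewrite /star_mean; field.
      by rewrite gt_eqF.
    by rewrite lerBlDr [NR R m ^+ d * star_scale m]mulrC.
  have p1 : 0 < (1 - star_loss m) * (1 - b) by rewrite mulr_gt0; lra.
  rewrite ler_pdivrMr // mulrC ler_pdivlMr // -(ler_pM2l Nd).
  by apply: le_trans h1; rewrite le_eqVlt; apply/orP; left; apply/eqP; ring.
- rewrite -[X in _ --> X]subr0; apply: cvgB; first exact: cvg_cst.
  exact: negligible_theta.
- rewrite -[X in _ --> X]invr1; apply: cvgV => //.
  rewrite -[X in _ --> X](mulr1 1); apply: cvgM; rewrite -[X in _ --> X]subr0; apply: cvgB;
  do [exact: cvg_cst|exact: star_loss_cvg0|exact: bad_cvg0].
Unshelve. all: by end_near. Qed.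

End Fixed.

Definition hom_density d (F : rel 'I_d) m : R :=
  #|homs F (4 * m)|%:R / (NR R m ^+ d * theta R m ^+ ecount F).

(** Even if every unspread tuple were a homomorphism, these would be negligible against
    [theta ^+ ecount F]. *)
Lemma hom_density_cvg1 d (F : rel 'I_d) : symmetric F -> irreflexive F ->
  hom_density F @ \oo --> (1 : R).
Proof.
elim: d F => [|d IH] F Fsym Firr.
  have -> : hom_density F = fun=> 1; last exact: cvg_cst.
  apply/funext => m; rewrite /hom_density /ecount big_ord0 !expr0 mulr1 divr1.
  have -> // : #|homs F (4 * m)| = 1%N.
  rewrite (eq_card (B := predT)); last first.
    by move=> x; rewrite !inE; apply/andP; split; apply/forallP => -[].
  by rewrite card_ffun card_ord expn0.
have F's : symmetric (del_max F) by move=> i j; apply: Fsym.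
have F'i : irreflexive (del_max F) by move=> i; apply: Firr.
have IHF := IH _ F's F'i.
set F' := del_max F in F's F'i IHF; set J := nbrs_max F.
pose u m := star_scale J m / star_mean J m.
have uc : u @ \oo --> (1 : R) := star_scale_cvg1 J.
pose g e m := bad_ratio R d m / theta R m ^+ e.
have gc e : g e @ \oo --> (0 : R).
  by apply: negligible_theta; [apply: bad_ratio_ge0|apply: negligible_bad_ratio].
apply: (@squeeze_cvgr _ _ _ _ (fun m => u m * (1 - star_loss d m) * (hom_density F' m - g (ecount F') m))
   (fun m => u m * hom_density F' m + g (ecount F' + #|J|)%N m)).
- near=> m.
  have [h0 er] : (0 < half_size R d m)%N /\ star_loss d m <= 1 / 2 by near: m; apply: near_good.
  have err1 : star_loss d m <= 1 by lra.
  have Hs : homs F' (4 * m) \subset tuples (4 * m) d.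
    by apply/subsetP => x; rewrite !inE => /andP[].
  have := star_sum_bounds J Hs h0 err1.
  rewrite -natr_sum -card_homs_extend // => /andP[h1 h2].
  have Nd : 0 < NR R m ^+ d by rewrite exprn_gt0 ?NR_gt0.
  have N0 := NR_gt0 R m; have t0 := theta_gt0 R m.
  have bE : num_unspread d m = bad_ratio R d m * NR R m ^+ d by rewrite /bad_ratio divfK ?gt_eqF.
  have D0 : 0 < NR R m ^+ d.+1 * theta R m ^+ ecount F by rewrite mulr_gt0 ?exprn_gt0.
  apply/andP; split.
    rewrite ler_pdivlMr //; apply: le_trans h1; rewrite bE.
    rewrite le_eqVlt; apply/orP; left; apply/eqP.
    rewrite /u /g /hom_density /star_mean (ecount_del_max F) -/F' -/J exprS !exprD; field.
    by rewrite !expf_neq0 ?gt_eqF.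
  rewrite ler_pdivrMr //; apply: le_trans h2 _; rewrite bE.
  rewrite le_eqVlt; apply/orP; left; apply/eqP.
  rewrite /u /g /hom_density /star_mean (ecount_del_max F) -/F' -/J exprS !exprD; field.
  by rewrite !expf_neq0 ?gt_eqF.
- have -> : nbhs (1 : R) = nbhs (1 * (1 - 0) * (1 - 0) : R) by congr nbhs; ring.
  apply: cvgM; first (apply: cvgM => //); (apply: cvgB => //); first exact: cvg_cst.
  exact: star_loss_cvg0.
- have -> : nbhs (1 : R) = nbhs (1 * 1 + 0 : R) by congr nbhs; ring.
  by apply: cvgD => //; apply: cvgM.
Unshelve. all: by end_near. Qed.

End HomAsymptotics.

(** * Copies and pairs of overlapping copies *)

Lemma set2_inj (T : finType) (a b c e : T) : [set a; b] = [set c; e] ->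
  (a = c /\ b = e) \/ (a = e /\ b = c).
Proof.
move=> /setP h.
have := h a; rewrite !inE eqxx /= => /esym/orP[]/eqP ?; subst a.
  have := h b; rewrite !inE eqxx orbT => /esym/orP[]/eqP ?; subst b; last by left.
  by have := h e; rewrite !inE eqxx orbT => /orP[]/eqP ->; left.
have := h b; rewrite !inE eqxx orbT => /esym/orP[]/eqP ?; subst b; first by right.
by have := h c; rewrite !inE eqxx => /orP[]/eqP ->; right.
Qed.

Section Copies.
Variables (k : nat) (F : rel 'I_k).
Hypothesis hF : simple_graph F.
Let Fsym i j : F i j = F j i := hF.1 i j.
Let Firr i : F i i = false := negbTE (hF.2 i).

Lemma mem_Fedges i j : F i j -> [set i; j] \in Fedges F.
Proof. by move=> Fij; apply/imset2P; exists i j => //; rewrite inE. Qed.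

Lemma FedgesP e : reflect (exists i j, F i j /\ e = [set i; j]) (e \in Fedges F).
Proof.
apply: (iffP imset2P) => [[i j _]|[i [j [Fij ->]]]]; first by rewrite inE => Fij ->; exists i, j.
by exists i j; rewrite ?inE.
Qed.

Lemma ecountE : ecount F = #|Fedges F|.
Proof.
pose P := [set ij : 'I_k * 'I_k | (ij.1 < ij.2) && F ij.1 ij.2]%N.
have -> : ecount F = #|P|.
  rewrite -sum1_card /ecount exchange_big pair_big /= [RHS]big_mkcond /=.
  by apply: eq_bigr => -[i j] _; rewrite inE /=; case: (_ && _).
rewrite -(card_in_imset (f := fun ij : 'I_k * 'I_k => [set ij.1; ij.2])); last first.
  move=> [i j] [i' j']; rewrite !inE /= => /andP[ij _] /andP[ij' _] /set2_inj[[-> ->] //|[e1 e2]].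
  by move: ij ij'; rewrite e1 e2 => h /(ltn_trans h); rewrite ltnn.
apply: eq_card => e; apply/imsetP/FedgesP => [[[i j]]|[i [j [Fij ->]]]].
  by rewrite inE /= => /andP[_ Fij] ->; exists i, j.
case: (ltngtP i j) => ij.
- by exists (i, j); rewrite // inE /= ij.
- by exists (j, i); [rewrite inE /= ij Fsym|rewrite setUC].
- by move: Fij; rewrite (val_inj ij) Firr.
Qed.

Section Fixed.
Variable n : nat.
Implicit Types g h : {ffun 'I_k -> {set 'I_n}}.

Definition edges g : {set {set {set 'I_n}}} := [set (g @: (e : {set 'I_k})) | e in Fedges F].
Definition emap g : {set {set 'I_n}} * {set {set {set 'I_n}}} := (g @: [set: 'I_k], edges g).
Definition injs : {set {ffun 'I_k -> {set 'I_n}}} := [set g in homs F n | injectiveb g].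
Definition copies := [set WS | is_copy F (Gedges n) WS].

Lemma edgesP g e : reflect (exists i j, F i j /\ e = [set g i; g j]) (e \in edges g).
Proof.
apply: (iffP imsetP) => [[_ /FedgesP[i [j [Fij ->]]] ->]|[i [j [Fij ->]]]].
  by exists i, j; rewrite imsetU1 imset_set1.
by exists [set i; j]; [exact: mem_Fedges|rewrite imsetU1 imset_set1].
Qed.

Lemma edgesE g : edges g = [set [set g i; g j] | i in [set: 'I_k], j in [set j0 | F i j0]].
Proof.
apply/setP => e; apply/edgesP/imset2P => [[i [j [Fij ->]]]|[i j _]].
  by exists i j; rewrite ?inE.
by rewrite inE => Fij ->; exists i, j.
Qed.

Lemma mem_edges g i j : injective g -> ([set g i; g j] \in edges g) = F i j.
Proof.
move=> gi; apply/edgesP/idP => [[i' [j' [Fij /set2_inj[[/gi -> /gi ->]//|[/gi -> /gi ->]]]]]|Fij].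
  by rewrite Fsym.
by exists i, j.
Qed.

Lemma card_edges g : injective g -> #|edges g| = #|Fedges F|.
Proof. by move=> gi; rewrite card_imset //; apply: imset_inj. Qed.

Lemma edges_sub g : (forall j, g j \in Vtx n) ->
  (edges g \subset Gedges n) = (g \in homs F n).
Proof.
move=> gV; rewrite inE; have -> /= : [forall j, g j \in Vtx n] by apply/forallP.
apply/subsetP/'forall_forallP => [gE i j|gF e /edgesP[i [j [Fij ->]]]].
  apply/implyP => Fij; have /imset2P[x y xV] : [set g i; g j] \in Gedges n.
    by apply: gE; apply/edgesP; exists i, j.
  by rewrite inE => /andP[_ xy] /set2_inj[[-> ->] //|[-> ->]]; rewrite setIC.
apply/imset2P; exists (g i) (g j); rewrite ?gV // inE gV /=.
by have /implyP := gF i j; apply.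
Qed.

Lemma injsP g : reflect [/\ forall j, g j \in Vtx n, edges g \subset Gedges n & injective g] (g \in injs).
Proof.
rewrite inE; apply: (iffP andP) => [[gh /injectiveP gi]|[gV gE gi]].
  have gV j : g j \in Vtx n by move: gh; rewrite inE => /andP[/forallP].
  by split=> //; rewrite edges_sub.
by rewrite -edges_sub //; split=> //; apply/injectiveP.
Qed.

Lemma copiesE : copies = [set emap g | g in injs].
Proof.
apply/setP => -[W S]; rewrite inE /is_copy /=; apply/andP/imsetP.
  case=> SE /existsP[g /and4P[/injectiveP gi /forallP gV /eqP -> /eqP eS]].
  rewrite -edgesE in eS.
  by exists g; rewrite ?eS //; apply/injsP; split=> //; rewrite -eS.
case=> g /injsP[gV gE gi] [-> ->]; split=> //; apply/existsP; exists g.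
by rewrite edgesE !eqxx !andbT; apply/andP; split; [apply/injectiveP|apply/forallP].
Qed.

(** The injections with a given image are one orbit of the automorphisms acting freely by
    precomposition. *)
Lemma card_injs : #|injs| = (#|copies| * n_aut F)%N.
Proof.
rewrite -sum1_card (partition_big emap (mem copies)) /=; last first.
  by move=> g gi; rewrite copiesE; apply: imset_f.
rewrite -sum_nat_const; apply: eq_bigr => a; rewrite copiesE => /imsetP[g0 /injsP[gV gE gi] ->].
rewrite sum1dep_card /n_aut; set A := [set s : {perm 'I_k} | _].
rewrite -(card_in_imset (f := fun s : {perm 'I_k} => [ffun i => g0 (s i)]) (D := mem A)); last first.
  move=> s t _ _ /ffunP e; apply/permP => i; apply: gi.
  by have := e i; rewrite !ffunE.
apply: eq_card => g; rewrite inE; apply/andP/imsetP.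
- case=> /injsP[hV hE hi] /eqP[eW eS].
  have pre i : exists i', g0 i' == g i.
    have : g i \in g0 @: [set: 'I_k] by rewrite -eW imset_f.
    by case/imsetP => i' _ ->; exists i'.
  pose s i := xchoose (pre i).
  have sE i : g0 (s i) = g i by apply/eqP; exact: xchooseP (pre i).
  have si : injective s by move=> i j /(congr1 g0); rewrite !sE => /hi.
  exists (perm si); last by apply/ffunP => i; rewrite ffunE permE sE.
  rewrite inE; apply/'forall_forallP => i j; rewrite !permE.
  by rewrite -(mem_edges _ _ gi) !sE -eS mem_edges.
- case=> s; rewrite inE => /'forall_forallP sF ->.
  have sFE i j : F (s i) (s j) = F i j by apply/eqP.
  have eE : edges [ffun i => g0 (s i)] = edges g0.
    apply/setP => e; apply/edgesP/edgesP => -[i [j [Fij ->]]].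
      by exists (s i), (s j); rewrite sFE !ffunE.
    by exists (s^-1%g i), (s^-1%g j); rewrite -sFE !ffunE !permKV.
  split.
    apply/injsP; split=> [j||i j]; [by rewrite ffunE; apply: gV|by rewrite eE|].
    by rewrite !ffunE => /gi/perm_inj.
  rewrite /emap eE; apply/eqP; congr (_, _); apply/setP => x.
  apply/imsetP/imsetP => -[i _ ->]; first by exists (s i); rewrite ?ffunE.
  by exists (s^-1%g i); [|rewrite ffunE permKV].
Qed.

Lemma n_copiesE (w : {set {set {set 'I_n}}}) : w \subset Gedges n ->
  n_copies F w = cnt copies snd w.
Proof.
move=> wG; apply: eq_card => WS; rewrite !inE /is_copy.
case: (boolP (WS.2 \subset w)) => /= [h|_]; last by rewrite andbF.
by rewrite (subset_trans h wG) andbT.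
Qed.

Lemma prob_XF_eqE (R : realType) (p : R) j :
  prob_XF_eq n p F j = pr (Gedges n) p copies snd j.
Proof.
rewrite /prob_XF_eq /pr big_mkcond /=; apply: eq_bigr => w _.
case: (boolP (w \subset Gedges n)) => wG.
  by rewrite n_copiesE //; case: eqP => _; rewrite ?mulr1 ?mulr0.
by rewrite /Gp_weight /wt (negbTE wG) mul0r if_same.
Qed.

Lemma copies_edges a : a \in copies -> a.2 \subset Gedges n /\ #|a.2| = #|Fedges F|.
Proof. by rewrite copiesE => /imsetP[g /injsP[gV gE gi] ->]; rewrite /= card_edges. Qed.

Definition overlap g h : {set 'I_k} := [set j | h j \in g @: [set: 'I_k]].

(* Strict balance, applied to the part of the second copy that lies in the first. *)
Lemma overlap_balanced (R : realType) g h : strictly_balanced R F ->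
  injective g -> injective h -> emap h != emap g -> ~~ [disjoint edges g & edges h] ->
  (#|edges g :&: edges h| * k < #|Fedges F| * #|overlap g h|)%N.
Proof.
move=> bal gi hi neq meet.
pose D := [set e in Fedges F | h @: (e : {set 'I_k}) \in edges g].
have hsi : injective (fun e : {set 'I_k} => h @: e) by apply: imset_inj.
have cD : #|edges g :&: edges h| = #|D|.
  rewrite -(card_imset _ hsi); apply: eq_card => e; rewrite inE; apply/andP/imsetP.
    by case=> eg /imsetP[e' e'F ee]; exists e' => //; rewrite inE e'F -ee.
  by case=> e'; rewrite inE => /andP[e'F eg] ->; split=> //; apply: imset_f.
have DU e : e \in D -> e \subset overlap g h.
  rewrite inE => /andP[_ /imsetP[e' _ he]]; apply/subsetP => j je; rewrite inE.
  have : h j \in h @: e by apply: imset_f.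
  by rewrite he => /imsetP[i _ ->]; apply: imset_f.
have DF : D \subset Fedges F by apply/subsetP => e; rewrite inE => /andP[].
have D0 : D != set0.
  rewrite -card_gt0 -cD card_gt0; by rewrite setI_eq0.
have U0 : overlap g h != set0.
  case/set0Pn: D0 => e eD; case/FedgesP: (subsetP DF e eD) => i [j [_ eij]].
  by apply/set0Pn; exists i; apply: (subsetP (DU e eD)); rewrite eij !inE eqxx.
(* If all vertices and all edges of the second copy lay in the first, equal cardinalities would make
   the copies coincide. *)
have proper : overlap g h != [set: 'I_k] \/ D != Fedges F.
  case: (eqVneq (overlap g h) [set: 'I_k]) => [eU|]; last by left.
  right; apply: contra neq => /eqP eD; rewrite /emap; apply/eqP; congr (_, _).
    apply/eqP; rewrite eqEcard !card_imset // leqnn andbT.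
    apply/subsetP => _ /imsetP[j _ ->].
    have jU : j \in overlap g h by rewrite eU.
    by rewrite inE in jU.
  apply/eqP; rewrite eqEcard !card_edges // leqnn andbT.
  by apply/subsetP => _ /imsetP[e eF ->]; move: eF; rewrite -{1}eD inE => /andP[].
have k0 : (0 < k)%N by have /set0Pn[i _] := U0; exact: leq_ltn_trans (leq0n i) (ltn_ord i).
move: (bal _ _ DF DU U0 proper).
rewrite ltr_pdivrMr ?ltr0n ?card_gt0 // mulrAC ltr_pdivlMr ?ltr0n //.
by rewrite -!natrM ltr_nat -cD.
Qed.

(** A vertex in [U] has at most [k] possible images, any other at most [NN n]. *)
Lemma card_overlap g (U : {set 'I_k}) :
  (#|[set h : {ffun 'I_k -> {set 'I_n}} | [forall j, h j \in Vtx n] && (overlap g h == U)]| <=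
   k ^ k * NN n ^ (k - #|U|))%N.
Proof.
pose Q j := if j \in U then mem (g @: [set: 'I_k]) else mem (Vtx n).
apply: leq_trans (_ : #|family Q| <= _)%N.
  apply: subset_leq_card; apply/subsetP => h; rewrite inE => /andP[/forallP hV /eqP hU].
  by apply/familyP => j; rewrite /Q; case: ifP; rewrite -?hU ?inE // => _; have := hV j; rewrite inE.
have -> : #|family Q| = (\prod_j \sum_(A in Q j) 1)%N.
  by rewrite bigA_distr_big_dep /= -sum1_card; apply: eq_bigr => f _; rewrite big1.
rewrite (bigID (mem U)) /=; apply: leq_mul.
  apply: leq_trans (_ : \prod_(i in U) k <= _)%N.
    apply: leq_prod => j jU; rewrite sum1_card /Q jU.
    by apply: leq_trans (leq_imset_card _ _) _; rewrite cardsT card_ord.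
  rewrite prod_nat_const.
  have Uk : (#|U| <= k)%N by rewrite -[leqRHS]card_ord max_card.
  have [k0|k0] := posnP k; last by rewrite leq_pexp2l.
  have -> : #|U| = 0%N by apply/eqP; rewrite -leqn0; apply: leq_trans Uk _; rewrite k0.
  by rewrite k0.
rewrite (eq_bigr (fun=> NN n)) => [|j /negbTE jU]; last by rewrite sum1_card /Q jU card_Vtx.
rewrite prod_nat_const.
by rewrite -[X in (X - _)%N]card_ord -(cardC (mem U)) addKn.
Qed.

(* Resetting coordinate [i] of a tuple with [x i = x j] is injective. *)
Lemma card_non_injective :
  (#|homs F n :\: injs| * NN n <= k ^ 2 * NN n ^ k)%N.
Proof.
pose S (ij : 'I_k * 'I_k) := [set x in tuples n k | (ij.1 != ij.2) && (x ij.1 == x ij.2)].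
have cS ij : (#|S ij| * NN n <= NN n ^ k)%N.
  case: ij => i j; have [e|ne] := eqVneq i j.
    rewrite (_ : S _ = set0) ?cards0 //; apply/setP => x.
    by rewrite !inE /= e eqxx andbF.
  rewrite -card_tuples -card_Vtx -cardsX.
  pose f (xA : {ffun 'I_k -> {set 'I_n}} * {set 'I_n}) : {ffun 'I_k -> {set 'I_n}} :=
    [ffun i' => if i' == i then xA.2 else xA.1 i'].
  rewrite -(card_in_imset (f := f)).
    apply: subset_leq_card; apply/subsetP => z /imsetP[[x A]].
    rewrite inE /= => /andP[]; rewrite inE => /andP[xV _] AV ->.
    move: xV; rewrite !inE => /forallP xV; apply/forallP => i'; rewrite ffunE.
    by case: eqP.
  move=> [x A] [y B]; rewrite inE [(y, B) \in _]inE /=.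
  move=> /andP[/setIdP[_ /andP[_ /eqP xij]] _] /andP[/setIdP[_ /andP[_ /eqP yij]] _] /ffunP e.
  have xy i' : i' != i -> x i' = y i' by move=> /negbTE ni; have := e i'; rewrite !ffunE ni.
  have -> : A = B by have := e i; rewrite !ffunE eqxx.
  congr (_, _); apply/ffunP => i'; have [->|/xy //] := eqVneq i' i.
  by rewrite /= in xij yij; rewrite xij yij xy // eq_sym.
apply: leq_trans (_ : (\sum_(ij : 'I_k * 'I_k) #|S ij|) * NN n <= _)%N.
  rewrite leq_mul2r; apply/orP; right.
  rewrite -sum1_card big_mkcond /=.
  apply: leq_trans (_ : \sum_(x : {ffun 'I_k -> {set 'I_n}}) \sum_(ij : 'I_k * 'I_k) (x \in S ij) <= _)%N.
    apply: leq_sum => x _; case: ifP => //; rewrite !inE => /andP[xi /andP[xV xF]].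
    move: xi; rewrite xV xF /= => /injectivePn[i [j ij xij]].
    by rewrite (bigD1 (i, j)) //= !inE xV ij xij eqxx.
  rewrite exchange_big /=; apply: leq_sum => ij _.
  by rewrite -sum1_card [leqRHS]big_mkcond /=; apply: leq_sum => x _; case: (x \in S ij).
rewrite big_distrl /=; apply: leq_trans (_ : \sum_(ij : 'I_k * 'I_k) NN n ^ k <= _)%N.
  by apply: leq_sum => ij _; apply: cS.
by rewrite sum_nat_const card_prod card_ord.
Qed.

End Fixed.
End Copies.

(** Replaces copies by injections in upper bounds; counting a copy once per automorphism does no
    harm there. *)
Lemma ler_sum_imset (R : realType) (S T : finType) (f : S -> T) (A : {set S}) (G : T -> R) :
  (forall t, 0 <= G t) -> \sum_(t in f @: A) G t <= \sum_(s in A) G (f s).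
Proof.
move=> G0; rewrite [leRHS](partition_big f (mem (f @: A))) /=; last first.
  by move=> s sA; apply: imset_f.
apply: ler_sum => t /imsetP[s sA ->].
by rewrite (bigD1 s) /= ?sA ?eqxx // lerDl sumr_ge0.
Qed.

(** The two sides without the 1 differ by [l * s - e * k], a positive integer. The 1 becomes the
    gain of one factor [N^(-1/l)]. *)
Lemma exponent_bound (k l s e : nat) : (e * k < l * s)%N -> (s <= k)%N ->
  ((2 * k - s) * l + 1 <= k * (2 * l - e))%N.
Proof.
move=> eks sk; have sl : (s * l <= k * l)%N by rewrite leq_mul2r sk orbT.
rewrite mulnBl mulnBr; nia.
Qed.

Section PairBound.
Variables (R : realType) (k : nat) (F : rel 'I_k) (n : nat) (p A : R).
Hypotheses (hF : simple_graph F) (bal : strictly_balanced R F) (p01 : 0 <= p <= 1).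
Let l := #|Fedges F|.
Let N : R := (NN n)%:R.
Hypothesis A0 : 0 <= A.
Hypothesis pA : forall s e, (e * k < l * s)%N -> (s <= k)%N ->
  p ^+ (2 * l - e) <= A * N ^- (2 * k - s).

(** There are at most [N ^ k] first injections and, for each overlap set of size [s],
    [k ^ k * N ^ (k - s)] second ones, which cancels the power of [N] in [pA]. The overlap sets
    contribute [2 ^ k], and one more 2 absorbs the product terms off the diagonal. *)
Lemma pairs_err_bound :
  pairs_err p (copies F n) snd <= 2 ^+ k.+1 * k%:R ^+ k * A + #|copies F n|%:R * p ^+ l * p ^+ l.
Proof.
have /andP[p0 p1] := p01.
have N0 : 0 < N by rewrite ltr0n bin_gt0 leq_div.
have lE a : a \in copies F n -> #|a.2| = l by case/copies_edges.
rewrite /pairs_err; apply: lerD; last first.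
  rewrite -mulrA -exprD mulr_natl -sumr_const; apply: ler_sum => a aC.
  by rewrite !lE.
pose W (g : {ffun 'I_k -> {set 'I_n}}) : R :=
  \sum_(h : {ffun 'I_k -> {set 'I_n}} | [forall j, h j \in Vtx n]) A * N ^- (2 * k - #|overlap g h|).
have Wle g : W g <= 2 ^+ k * k%:R ^+ k * A * N ^- k.
  rewrite /W (partition_big (overlap g) xpredT) //=.
  apply: le_trans (_ : \sum_(U : {set 'I_k}) k%:R ^+ k * A * N ^- k <= _); last first.
    by rewrite sumr_const card_subsets card_ord -[leLHS]mulr_natl natrX !mulrA.
  apply: ler_sum => U _.
  rewrite (eq_bigr (fun=> A * N ^- (2 * k - #|U|))); last by move=> h /andP[_ /eqP ->].
  rewrite sumr_const -[leLHS]mulr_natl.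
  have Uk : (#|U| <= k)%N by rewrite -[leqRHS]card_ord max_card.
  apply: le_trans (_ : (k ^ k * NN n ^ (k - #|U|))%:R * (A * N ^- (2 * k - #|U|)) <= _).
    rewrite ler_wpM2r ?mulr_ge0 ?invr_ge0 ?exprn_ge0 ?(ltW N0) // ler_nat.
    apply: leq_trans (card_overlap g U); apply: eq_leq; apply: eq_card => h.
    by rewrite !inE.
  rewrite natrM !natrX -/N.
  have -> : (2 * k - #|U| = (k - #|U|) + k)%N by lia.
  rewrite exprD le_eqVlt; apply/orP; left; apply/eqP; field.
  by rewrite !expf_neq0 ?gt_eqF.
have inner a b : a \in copies F n -> b \in copies F n ->
    p ^+ #|a.2 :|: b.2| + p ^+ (#|a.2| + #|b.2|) <= 2 * p ^+ #|a.2 :|: b.2|.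
  move=> aC bC; rewrite mulr2n mulrDl mul1r lerD2l.
  by apply: ler_wiXn2l; rewrite ?p0 ?p1 // cardsU leq_subr.
pose G (a b : {set {set 'I_n}} * {set {set {set 'I_n}}}) : R :=
  if (b != a) && meets snd a b then 2 * p ^+ #|a.2 :|: b.2| else 0.
have G0 a b : 0 <= G a b by rewrite /G; case: ifP => // _; rewrite mulr_ge0 ?exprn_ge0.
apply: le_trans (_ : \sum_(a in copies F n) \sum_(b in copies F n) G a b <= _).
  apply: ler_sum => a aC; rewrite big_mkcondr /=; apply: ler_sum => b bC.
  by rewrite /G; case: ifP => // _; apply: inner.
rewrite copiesE.
apply: le_trans (ler_sum_imset _ _ _) _; first by move=> a; apply: sumr_ge0.
apply: le_trans (_ : \sum_(g in injs F n) 2 * W g <= _).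
  apply: ler_sum => g gI; apply: le_trans (ler_sum_imset _ _ (G0 _)) _.
  rewrite /W mulr_sumr big_mkcond [leRHS]big_mkcond /=; apply: ler_sum => h _.
  case: (boolP (h \in injs F n)) => hI; last first.
    case: ifP => // _; rewrite !mulr_ge0 ?invr_ge0 ?exprn_ge0 ?(ltW N0) //.
  have [gV _ gi] := injsP F g gI; have [hV _ hi] := injsP F h hI.
  rewrite (_ : [forall j, _]); last exact/forallP.
  rewrite /G; case: ifP => [/andP[neq meet]|_]; last first.
    by rewrite !mulr_ge0 ?invr_ge0 ?exprn_ge0 ?(ltW N0).
  rewrite ler_wpM2l // cardsU !card_edges // -/l addnn -mul2n; apply: pA.
    exact: overlap_balanced bal gi hi neq meet.
  by rewrite -[leqRHS]card_ord max_card.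
apply: le_trans (_ : \sum_(g in injs F n) 2 * (2 ^+ k * k%:R ^+ k * A * N ^- k) <= _).
  by apply: ler_sum => g _; rewrite ler_wpM2l.
rewrite sumr_const -[leLHS]mulr_natl.
apply: le_trans (_ : N ^+ k * (2 * (2 ^+ k * k%:R ^+ k * A * N ^- k)) <= _).
  rewrite ler_wpM2r ?mulr_ge0 ?invr_ge0 ?exprn_ge0 ?(ltW N0) //.
  rewrite /N -natrX -card_tuples ler_nat; apply: subset_leq_card; apply/subsetP => g.
  by rewrite !inE => /andP[/andP[]].
rewrite exprS le_eqVlt; apply/orP; left; apply/eqP; field.
by rewrite expf_neq0 ?gt_eqF.
Qed.
End PairBound.

Local Open Scope classical_set_scope.

Lemma cvgr0_root (R : realType) (f : nat -> R) e : (0 < e)%N -> (forall m, 0 <= f m) ->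
  (fun m => f m ^+ e) @ \oo --> (0 : R) -> f @ \oo --> (0 : R).
Proof.
move=> e0 f0 /cvgr0Pnorm_le fe; apply/cvgr0Pnorm_le => eps eps0.
near=> m; rewrite ger0_norm //.
rewrite -(@ler_pXn2r _ e) ?nnegrE ?(ltW eps0) //.
rewrite -[leLHS]ger0_norm ?exprn_ge0 //.
by near: m; apply: fe; rewrite exprn_gt0.
Unshelve. all: by end_near. Qed.

(** * Limits of the expectation and of the pair sums *)

Section Assembly.
Variables (R : realType) (k : nat) (F : rel 'I_k).
Hypotheses (hF : simple_graph F) (hl : (1 <= #|Fedges F|)%N) (hbal : strictly_balanced R F).
Variables (c : R) (hc : 0 < c) (p : nat -> R).
Hypothesis hp01 : forall m : nat, 0 <= p (4 * m)%N <= 1.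
Let l := #|Fedges F|.

(** [N^(-1/l)]: in terms of it, [p] is of order [nroot ^+ k / theta], with natural exponents
    only. *)
Definition nroot m : R := NR R m `^ (- (l%:R)^-1).

Lemma nroot_gt0 m : 0 < nroot m.
Proof. by rewrite powR_gt0 // NR_gt0. Qed.

Lemma nrootX e : forall m, nroot m ^+ e = NR R m `^ (- (e%:R / l%:R)).
Proof.
move=> m; rewrite /nroot -powR_mulrn ?powR_ge0 // -powRrM; congr (_ `^ _); ring.
Qed.

Lemma nrootXl m : nroot m ^+ l = (NR R m)^-1.
Proof.
rewrite nrootX divff; last by rewrite pnatr_eq0 -lt0n.
by rewrite powRN powRr1 // ltW // NR_gt0.
Qed.

Lemma nroot_le1 m : nroot m <= 1.
Proof.
rewrite -(@ler_pXn2r _ l) ?nnegrE ?(ltW (nroot_gt0 m)) // nrootXl expr1n.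
rewrite invf_le1 ?NR_gt0 // ler1n -(ltr_nat R); exact: NR_gt0.
Qed.

(** The [l]-th power is [N^-1] over a power of [theta]: exponentially small over polynomially
    small. *)
Lemma nroot_theta_cvg0 e : (fun m => nroot m / theta R m ^+ e) @ \oo --> (0 : R).
Proof.
apply: (@cvgr0_root _ _ l) => // [m|].
  by rewrite divr_ge0 ?exprn_ge0 // ltW ?nroot_gt0 ?theta_gt0.
under eq_fun do rewrite exprMn nrootXl exprVn -exprM.
by apply: negligible_theta; [move=> m; rewrite invr_ge0 ltW ?NR_gt0|apply: negligible_NRV].
Qed.

Lemma injs_density_cvg1 :
  (fun m => #|injs F (4 * m)|%:R / (NR R m ^+ k * theta R m ^+ l)) @ \oo --> (1 : R).
Proof.
have Fsym : symmetric F := hF.1.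
have Firr : irreflexive F by move=> i; exact: negbTE (hF.2 i).
have h1 := @hom_density_cvg1 R _ _ Fsym Firr.
have h2 : (fun m => k%:R ^+ 2 * ((NR R m)^-1 / theta R m ^+ l)) @ \oo --> (0 : R).
  rewrite -(mulr0 (k%:R ^+ 2)); apply: cvgMr.
  by apply: negligible_theta; [move=> m; rewrite invr_ge0 ltW ?NR_gt0|apply: negligible_NRV].
apply: (@squeeze_cvgr _ _ _ _
  (fun m => hom_density R F m - k%:R ^+ 2 * ((NR R m)^-1 / theta R m ^+ l)) (hom_density R F)) => //.
- near=> m.
  have N0 := NR_gt0 R m; have t0 := theta_gt0 R m.
  have D0 : 0 < NR R m ^+ k * theta R m ^+ l by rewrite mulr_gt0 ?exprn_gt0.
  have sub : injs F (4 * m) \subset homs F (4 * m) by apply/subsetP => g; rewrite inE => /andP[].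
  rewrite /hom_density (ecountE hF) -/l; apply/andP; split; last first.
    by rewrite ler_wpM2r ?invr_ge0 ?(ltW D0) // ler_nat subset_leq_card.
  have := card_non_injective F (4 * m).
  rewrite -(ler_nat R) !natrM !natrX -/(NR R m) => h.
  rewrite -(cardsID (injs F (4 * m)) (homs F (4 * m))) (setIidPr sub) natrD mulrDl.
  rewrite lerBlDr lerD2l ler_pdivrMr // -(ler_pM2r N0); apply: le_trans h _.
  have alg (N t K Nk : R) e : 0 < N -> 0 < t ->
      K * K * Nk = K ^+ 2 * (N^-1 / t ^+ e) * (Nk * t ^+ e) * N.
    by move=> N_gt0 t_gt0; field; rewrite expf_neq0 ?gt_eqF.
  by rewrite le_eqVlt (alg _ _ _ _ l N0 t0) eqxx.
- by rewrite -[X in _ --> X]subr0; apply: cvgB.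
Unshelve. all: by end_near. Qed.

Hypothesis hp : (fun m : nat =>
          p (4 * m)%N /
          (c * ((NN (4 * m))%:R `^ (- (k%:R / (#|Fedges F|)%:R)))
             * ((NN (4 * m))%:R / (NN1 (4 * m))%:R))) @ \oo --> (1 : R).

Definition pratio m : R := p (4 * m)%N / (c * nroot m ^+ k / theta R m).

Lemma pratio_cvg1 : pratio @ \oo --> (1 : R).
Proof.
suff -> : pratio = (fun m => p (4 * m)%N / (c * ((NN (4 * m))%:R `^ (- (k%:R / l%:R))) *
   ((NN (4 * m))%:R / (NN1 (4 * m))%:R))) by [].
apply/funext => m; have tV : (theta R m)^-1 = NR R m / (NN1 (4 * m))%:R by rewrite invf_div.
by rewrite /pratio nrootX tV.
Qed.

Lemma p_pratioE m : p (4 * m)%N = pratio m * (c * nroot m ^+ k / theta R m).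
Proof.
by rewrite /pratio divfK // gt_eqF // divr_gt0 ?theta_gt0 // mulr_gt0 ?exprn_gt0 ?nroot_gt0.
Qed.

Lemma n_aut_gt0 : (0 < n_aut F)%N.
Proof.
apply/card_gt0P; exists 1%g; rewrite inE; apply/'forall_forallP => i j.
by rewrite !perm1.
Qed.

Lemma expected_copies_cvg :
  (fun m => #|copies F (4 * m)|%:R * p (4 * m)%N ^+ l) @ \oo --> c ^+ l / (n_aut F)%:R.
Proof.
have a0 : (n_aut F)%:R != 0 :> R by rewrite pnatr_eq0 -lt0n n_aut_gt0.
have -> : (fun m => #|copies F (4 * m)|%:R * p (4 * m)%N ^+ l) =
  (fun m => c ^+ l / (n_aut F)%:R * ((#|injs F (4 * m)|%:R / (NR R m ^+ k * theta R m ^+ l)) *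
     pratio m ^+ l)).
  apply/funext => m; rewrite p_pratioE (card_injs hF) natrM.
  have N0 := NR_gt0 R m; have t0 := theta_gt0 R m.
  move: (pratio m) (theta R m) t0 => x t t0; rewrite !exprMn !exprVn -exprM [(k * l)%N]mulnC exprM nrootXl exprVn.
  have alg (C r d Nk tl a : R) : a != 0 -> Nk != 0 -> tl != 0 ->
      C * (r * (d / Nk / tl)) = d / a * (C * a / (Nk * tl) * r).
    by move=> a_neq0 Nk_neq0 tl_neq0; field; rewrite a_neq0 Nk_neq0 tl_neq0.
  by apply: alg => //; rewrite expf_neq0 ?gt_eqF.
have -> : nbhs (c ^+ l / (n_aut F)%:R : R) = nbhs (c ^+ l / (n_aut F)%:R * (1 * 1 ^+ l) : R).
  by rewrite expr1n !mulr1.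
apply: cvgMr; apply: cvgM; first exact: injs_density_cvg1.
by apply: cvgr_expn; exact: pratio_cvg1.
Qed.

Lemma k_gt0 : (0 < k)%N.
Proof.
move: hl; rewrite lt0n cards_eq0 => /set0Pn[e /FedgesP[i _]].
exact: leq_ltn_trans (leq0n i) (ltn_ord i).
Qed.

Lemma p_cvg0 : (fun m => p (4 * m)%N) @ \oo --> (0 : R).
Proof.
have h : (fun m => (2 * c) * (nroot m / theta R m ^+ 1)) @ \oo --> (0 : R).
  by rewrite -(mulr0 (2 * c)); apply: cvgMr; apply: nroot_theta_cvg0.
apply: (squeeze_cvgr _ (cvg_cst (0 : R)) h).
near=> m.
have /andP[-> _] /= := hp01 m; rewrite p_pratioE expr1.
have r2 : pratio m <= 2.
  have : `|1 - pratio m| <= 1 by near: m; move/cvgrPdist_le: pratio_cvg1; apply.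
  by rewrite ler_norml => /andP[]; lra.
have q0 : 0 < nroot m := nroot_gt0 m; have t0 := theta_gt0 R m.
apply: le_trans (_ : 2 * (c * nroot m ^+ k / theta R m) <= _).
  by rewrite ler_wpM2r // ltW // divr_gt0 // mulr_gt0 // exprn_gt0.
rewrite -!mulrA ler_wpM2l // ler_wpM2l ?(ltW hc) // ler_wpM2r ?invr_ge0 ?(ltW t0) //.
by rewrite -[k]prednK ?k_gt0 // exprS ler_piMr ?(ltW q0) // exprn_ile1 ?(ltW q0) ?nroot_le1.
Unshelve. all: by end_near. Qed.

Lemma pairs_err_cvg0 :
  (fun m => pairs_err (p (4 * m)%N) (copies F (4 * m)) snd) @ \oo --> (0 : R).
Proof.
(* [2 * c] dominates [c * pratio m] for large [m]; the added 1 makes [Q / theta] at least 1, so that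
   its exponent [2 * l - e] may be raised to [2 * l]. *)
pose Q : R := 2 * c + 1.
have Q1 : 1 <= Q by rewrite /Q; have := hc; lra.
pose A m := Q ^+ (2 * l) * (nroot m / theta R m ^+ (2 * l)).
have Ac : A @ \oo --> (0 : R).
  by rewrite -(mulr0 (Q ^+ (2 * l))); apply: cvgMr; apply: nroot_theta_cvg0.
have h : (fun m => 2 ^+ k.+1 * k%:R ^+ k * A m +
    #|copies F (4 * m)|%:R * p (4 * m)%N ^+ l * p (4 * m)%N ^+ l) @ \oo --> (0 : R).
  have -> : nbhs (0 : R) = nbhs (2 ^+ k.+1 * k%:R ^+ k * 0 + c ^+ l / (n_aut F)%:R * 0 ^+ l : R).
    by rewrite expr0n -/l (gtn_eqF hl) !mulr0 addr0.
  apply: cvgD; first exact: cvgMr.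
  by apply: cvgM; [apply: expected_copies_cvg|apply: cvgr_expn p_cvg0].
apply: (squeeze_cvgr _ (cvg_cst (0 : R)) h).
near=> m.
have /andP[p0 p1] := hp01 m.
have q0 : 0 < nroot m := nroot_gt0 m; have t0 := theta_gt0 R m.
have N0 := NR_gt0 R m.
have q1 := nroot_le1 m; have t1 := theta_le1 R m.
have r2 : pratio m <= 2.
  have : `|1 - pratio m| <= 1 by near: m; move/cvgrPdist_le: pratio_cvg1; apply.
  by rewrite ler_norml => /andP[]; lra.
apply/andP; split.
  rewrite addr_ge0 //; first apply: sumr_ge0 => a _; last by apply: sumr_ge0 => a _; rewrite exprn_ge0.
  by apply: sumr_ge0 => b _; rewrite addr_ge0 ?exprn_ge0.
apply: pairs_err_bound => //.
  apply: mulr_ge0; first by rewrite exprn_ge0 // (le_trans _ Q1).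
  by rewrite divr_ge0 ?exprn_ge0 ?(ltW q0) ?(ltW t0).
move=> s e eks sk.
have el : (e < l)%N.
  rewrite -(ltn_pmul2r k_gt0); apply: leq_trans eks _.
  by rewrite leq_mul2l sk orbT.
have pQ : p (4 * m)%N <= Q / theta R m * nroot m ^+ k.
  rewrite p_pratioE mulrA [leRHS]mulrAC ler_wpM2r ?invr_ge0 ?(ltW t0) // mulrA.
  rewrite ler_wpM2r ?exprn_ge0 ?(ltW q0) // (le_trans (_ : _ <= 2 * c)) //.
    by rewrite ler_wpM2r // ltW.
  by rewrite /Q; lra.
have Qt1 : 1 <= Q / theta R m.
  by rewrite ler_pdivlMr // mul1r; apply: le_trans t1 _.
apply: le_trans (_ : (Q / theta R m * nroot m ^+ k) ^+ (2 * l - e) <= _).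
  by rewrite lerXn2r ?nnegrE //; apply: le_trans pQ.
have -> : A m * (NN (4 * m))%:R ^- (2 * k - s) =
    (Q / theta R m) ^+ (2 * l) * nroot m ^+ ((2 * k - s) * l + 1).
  rewrite /A -/(NR R m) -exprVn -nrootXl -exprM [(l * _)%N]mulnC exprD expr1.
  have alg (a b x y : R) : a * (y / b) * x = a / b * (x * y) by ring.
  by rewrite [(Q / _) ^+ _]expr_div_n; apply: alg.
rewrite exprMn -exprM; apply: ler_pM; rewrite ?exprn_ge0 ?(ltW q0) //.
- lra.
- by rewrite ler_weXn2l // leq_subr.
- apply: ler_wiXn2l; rewrite ?(ltW q0) ?q1 //.
  exact: exponent_bound.
Unshelve. all: by end_near. Qed.

Lemma prob_XF_eq_cvg j :
  (fun m => prob_XF_eq (4 * m)%N (p (4 * m)%N) F j) @ \oo --> poisson_pmf (c ^+ l / (n_aut F)%:R) j.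
Proof.
have mE m : mean (p (4 * m)%N) (copies F (4 * m)) snd = #|copies F (4 * m)|%:R * p (4 * m)%N ^+ l.
  rewrite /mean (eq_bigr (fun=> p (4 * m)%N ^+ l)) => [|a /copies_edges[_ ->] //].
  by rewrite sumr_const -[LHS]mulr_natl.
have EG m a : a \in copies F (4 * m) -> a.2 \subset Gedges (4 * m) by case/copies_edges.
have E0 m a : a \in copies F (4 * m) -> a.2 != set0.
  by case/copies_edges => _ e; rewrite -card_gt0 e.
under eq_fun do rewrite prob_XF_eqE.
apply: (@poisson_limit R (fun m j => pr (Gedges (4 * m)) (p (4 * m)%N) (copies F (4 * m)) snd j)
  (fun m => mean (p (4 * m)%N) (copies F (4 * m)) snd)).
- by rewrite divr_gt0 ?exprn_gt0 ?ltr0n ?n_aut_gt0.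
- by move=> m i; apply: pr_ge0.
- move=> i; apply/norm_cvg0P.
  apply: (squeeze_cvgr _ (cvg_cst (0 : R)) pairs_err_cvg0).
  near=> m; rewrite /= normr_ge0 /=.
  exact: (pr_recursion (hp01 m) (EG m) (E0 m) i).
- by under eq_fun do rewrite mE; apply: expected_copies_cvg.
- by move=> m K; apply: sum_pr_le1.
- by move=> m K; apply: sum_pr_ge; [apply: hp01|apply: EG].
Unshelve. all: by end_near. Qed.

End Assembly.

(** For laws on the natural numbers, convergence of each point probability to that of a probability
    law is convergence in distribution; [4 * m] runs through the multiples of 4. *)
Theorem theorem6 (R : realType) (k : nat) (F : rel 'I_k)
  (hF : simple_graph F) (hl : (1 <= #|Fedges F|)%N)
  (hbal : strictly_balanced R F)
  (c : R) (hc : 0 < c) (p : nat -> R)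
  (hp01 : forall m : nat, 0 <= p (4 * m)%N <= 1)
  (hp : (fun m : nat =>
          p (4 * m)%N /
          (c * ((NN (4 * m))%:R `^ (- (k%:R / (#|Fedges F|)%:R)))
             * ((NN (4 * m))%:R / (NN1 (4 * m))%:R))) @ \oo --> (1 : R)) :
  forall j : nat,
    (fun m : nat => prob_XF_eq (4 * m)%N (p (4 * m)%N) F j) @ \oo -->
      poisson_pmf (c ^+ #|Fedges F| / (n_aut F)%:R) j.
Proof. exact: prob_XF_eq_cvg. Qed.
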